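(* Let $\mathbb{X}$ be a Polish space, $H$ a probability measure on $\mathbb{X}$, $\mathfrak{q}$ an EPPF, and let $(\xi_n)_{n\ge1}$ be a $gSSS(\mathfrak{q},H)$. Denote by $\tilde\Pi=(\tilde\Pi_n)_{n\geq 1}$ the random partition induced by $(\xi_n)_{n\ge1}$. If $\pi_n=[\pi_{1,n},\dots,\pi_{k,n}]$ is a partition of $[n]$ with $|\pi_{i,n}|=n_i$ $(i=1,\dots,k)$ and $\boldsymbol{n}=(n_1,\dots,n_k)$, then $$P\{\tilde\Pi_n=\pi_n\}=\sum_{\boldsymbol{m}\in\mathcal{M}(\boldsymbol{n})}H^{\#}(\boldsymbol{m})\sum_{\boldsymbol{\lambda}\in\Lambda(\boldsymbol{m})}\boldsymbol{c}(\boldsymbol{\lambda})\,\tilde{\mathfrak{q}}(\boldsymbol{\lambda}).$$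
   Context: A partition of $[n]=\{1,\dots,n\}$ has its blocks listed in increasing order of smallest elements. A random partition of $\mathbb{N}$ is a sequence $\Pi=(\Pi_n)_{n\ge1}$ of random partitions of $[n]$ that are consistent under restriction; it is exchangeable if the law of each $\Pi_n$ is invariant under permutations of $[n]$. Its EPPF is the unique symmetric function $\mathfrak{q}$ on finite sequences of positive integers with $P\{\Pi_n=\pi_n\}=\mathfrak{q}(|\pi_{1,n}|,\dots,|\pi_{k,n}|)$ for each partition $\pi_n$ of $[n]$ with $k$ blocks. Kingman's correspondence is the bijection between EPPFs and laws of random ranked weights $p_1^\downarrow\ge p_2^\downarrow\ge\dots\ge0$, $\sum_jp_j^\downarrow\le1$, in which $p_j^\downarrow$ is the a.s. limit of the $j$-th largest block size of $\Pi_n$ divided by $n$. $(\xi_n)_{n\ge1}$ is a $gSSS(\mathfrak{q},H)$ if the $\xi_n$ are conditionally i.i.d. with law $P$ given a random probability measure $P$ distributed as $\sum_{j\ge1}p_j\delta_{Z_j}$, where $(Z_j)$ are i.i.d. with law $H$ ($H$ may have atoms), $(p_j)$ are random weights in $[0,1]$ with $\sum_jp_j=1$ a.s., independent of $(Z_j)$, and the EPPF corresponding via Kingman to the decreasing rearrangement of $(p_j)$ is $\mathfrak{q}$. The random partition induced by $(\xi_n)$ is that given by the equivalence relation $i\sim j$ iff $\xi_i=\xi_j$. For a vector $\boldsymbol{n}=(n_1,\dots,n_k)$ of positive integers with sum $n$: $$\mathcal{M}(\boldsymbol{n})=\{\boldsymbol{m}=(m_1,\dots,m_k)\in\mathbb{N}^k:1\le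 m_i\le n_i\}.$$ For $\boldsymbol{m}\in\mathcal{M}(\boldsymbol{n})$, $\Lambda(\boldsymbol{m})$ is the set of $\boldsymbol{\lambda}=[\boldsymbol{\lambda}_1,\dots,\boldsymbol{\lambda}_k]$ where $\boldsymbol{\lambda}_i=(\lambda_{i1},\dots,\lambda_{in_i})$ is a vector of nonnegative integers with $\sum_{j=1}^{n_i}j\lambda_{ij}=n_i$ and $\sum_{j=1}^{n_i}\lambda_{ij}=m_i$ for $i=1,\dots,k$. For $\boldsymbol{\lambda}\in\Lambda(\boldsymbol{m})$, $$\boldsymbol{c}(\boldsymbol{\lambda})=\prod_{i=1}^k\frac{n_i!}{\prod_{j=1}^{n_i}\lambda_{ij}!(j!)^{\lambda_{ij}}},\qquad \tilde{\mathfrak{q}}(\boldsymbol{\lambda})=\mathfrak{q}(n_{11},\dots,n_{1m_1},n_{21},\dots,n_{km_k}),$$ where $(n_{ic})$ is any array of positive integers with $\sum_{c=1}^{m_i}n_{ic}=n_i$ for every $i$ and $\#\{c:n_{ic}=j\}=\lambda_{ij}$ for every $i,j$ (by symmetry of $\mathfrak{q}$ the value does not depend on the choice). $H^{\#}(\boldsymbol{m})$ is the probability that, in an i.i.d. sample of size $m_1+\dots+m_k$ from $H$ divided into $k$ ordered blocks of cardinalities $m_1,\dots,m_k$, the observations within each block are equal and observations in distinct blocks are different; i.e. for $V_{i,c}$ ($1\le i\le k$, $1\le c\le m_i$) i.i.d. with law $H$, $H^{\#}(\boldsymbol{m})=P\{V_{i,c}=V_{i',c'}\Leftrightarrow i=i'\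 \text{for all}\ (i,c),(i',c')\}$. *)

(* Defs.v *)
From HB Require Import structures.
From mathcomp Require Import all_boot all_order all_algebra all_fingroup finmap.
From mathcomp Require Import all_classical all_reals all_analysis.
Set Implicit Arguments.
Unset Strict Implicit.
Unset Printing Implicit Defensive.
Import Order.TTheory GRing.Theory Num.Theory.
Import numFieldNormedType.Exports.
Local Open Scope classical_set_scope.
Local Open Scope ring_scope.

Definition is_distance (R : realType) (X : Type) (dist : X -> X -> R) :=
  [/\ forall x y, 0 <= dist x y,
      forall x y, dist x y = 0 <-> x = y,
      forall x y, dist x y = dist y x
    & forall x y z, dist x z <= dist x y + dist y z].

(* A topological property: the distance is not part of the structure on X. *)
Definition polish (R : realType) (X : topologicalType) :=
  (exists2 D : set X, countable D & dense D) /\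
  exists dist : X -> X -> R,
    [/\ is_distance dist,
        forall (x : X) (A : set X),
          nbhs x A <-> exists2 e, 0 < e & [set y | dist x y < e] `<=` A
      & forall u : nat -> X,
          (forall e, 0 < e -> exists N, forall m n,
             (N <= m)%N -> (N <= n)%N -> dist (u m) (u n) < e) ->
          exists l : X, u @ \oo --> l].

(* Measurable types are pointed, hence ptopologicalType; this is harmless, as
   a space that carries a probability measure is not empty. *)
Notation borel X := (g_sigma_algebraType (@open X)).

Section laws.
Context (R : realType).

(* T^N with the product sigma-algebra. *)
Definition cylinders d (T : measurableType d) : set (set (nat -> T)) :=
  \bigcup_i preimage_set_system setT (fun s : nat -> T => s i) measurable.
Arguments cylinders {d} T.

Notation seqspace T := (g_sigma_algebraType (cylinders T)).

Definition trajectory (Omega : Type) d (T : measurableType d)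
    (X : nat -> Omega -> T) : Omega -> seqspace T :=
  fun w i => X i w.

(* Equality on measurable sets only: measures in the library are functions on
   all sets, whose values on non-measurable sets are irrelevant. *)
Definition eq_law d1 d2 d (Omega1 : measurableType d1)
    (Omega2 : measurableType d2) (T : measurableType d)
    (P1 : probability Omega1 R) (P2 : probability Omega2 R)
    (X1 : Omega1 -> T) (X2 : Omega2 -> T) :=
  forall A : set T, measurable A -> P1 (X1 @^-1` A) = P2 (X2 @^-1` A).

Definition independent2 d d1 d2 (Omega : measurableType d)
    (T1 : measurableType d1) (T2 : measurableType d2)
    (P : probability Omega R) (X1 : Omega -> T1) (X2 : Omega -> T2) :=
  forall (A : set T1) (B : set T2), measurable A -> measurable B ->
  (P (X1 @^-1` A `&` X2 @^-1` B) = P (X1 @^-1` A) * P (X2 @^-1` B))%E.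

Definition iid d d' (Omega : measurableType d) (T : measurableType d')
    (P : probability Omega R) (X : nat -> {RV P >-> T})
    (H : probability T R) :=
  (forall i (A : set T), measurable A -> P (X i @^-1` A) = H A) /\
  (forall (J : {fset nat}) (A : nat -> set T), (forall i, measurable (A i)) ->
   P (\bigcap_(i in [set` J]) X i @^-1` A i) =
   (\prod_(i <- J) P (X i @^-1` A i))%E).

(* H^n(A), by iterated integration as in the binary product measure. *)
Fixpoint iid_sample_law d (T : measurableType d) (H : probability T R)
    (n : nat) : set (n.-tuple T) -> \bar R :=
  match n with
  | 0 => fun A => \d_([tuple] : 0.-tuple T) A
  | n'.+1 => fun A =>
      (\int[H]_x iid_sample_law H [set v : n'.-tuple T | A [tuple of x :: v]])%E
  end.

(* A random probability measure is a random element of [pprobability T R], the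
   space of probability measures with the sigma-algebra generated by the
   evaluations. The identity below says that
     P(X_0 \in A_0, .., X_(n-1) \in A_(n-1) | mu) = \prod_i mu(A_i)  a.s. *)
Definition conditionally_iid d d' (Omega : measurableType d)
    (T : measurableType d') (P : probability Omega R)
    (X : nat -> {RV P >-> T}) (mu : {RV P >-> pprobability T R}) :=
  forall n (A : nat -> set T) (C : set (pprobability T R)),
    (forall i, measurable (A i)) -> measurable C ->
    P (mu @^-1` C `&` \bigcap_(i in `I_n) X i @^-1` A i) =
    (\int[P]_(w in mu @^-1` C) \prod_(i < n) (mu w : probability T R) (A i))%E.

End laws.
Notation seqspace T := (g_sigma_algebraType (cylinders T)).

(* The set {1,...,n} is rendered by 'I_n, and a partition by its set of blocks. *)

(* Elements of A are found in increasing order; this is n when A is empty. *)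
Definition least n (A : {set 'I_n}) : nat :=
  find (fun i => i \in A) (enum 'I_n).

Definition blocks n (pi : {set {set 'I_n}}) : seq {set 'I_n} :=
  sort (fun A B => (least A <= least B)%N) (enum pi).

Definition block_sizes n (pi : {set {set 'I_n}}) : seq nat :=
  [seq #|A| | A : {set 'I_n} <- blocks pi].

(* j counts from 0; the value is 0 when there are at most j blocks. *)
Definition ranked_block_size n (pi : {set {set 'I_n}}) (j : nat) : nat :=
  nth 0%N (sort geq (block_sizes pi)) j.

Definition restrict m n (le_mn : (m <= n)%N) (pi : {set {set 'I_n}}) :
    {set {set 'I_m}} :=
  ([set widen_ord le_mn @^-1: A | A : {set 'I_n} in pi] :\ finset.set0)%SET.

Definition induced_partition (T : eqType) (x : nat -> T) (n : nat) :
    {set {set 'I_n}} :=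
  equivalence_partition (fun i j : 'I_n => x i == x j) [set: 'I_n]%SET.

Section random_partitions.
Context (R : realType).

Definition random_partition d (Omega : measurableType d)
    (Pi : forall n, Omega -> {set {set 'I_n}}) :=
  [/\ forall n w, finset.partition (Pi n w) [set: 'I_n]%SET,
      forall n (pi : {set {set 'I_n}}), measurable [set w | Pi n w = pi]
    & forall m n (le_mn : (m <= n)%N) w, restrict le_mn (Pi n w) = Pi m w].

Definition exchangeable d (Omega : measurableType d) (P : probability Omega R)
    (Pi : forall n, Omega -> {set {set 'I_n}}) :=
  forall n (s : 'S_n) (pi : {set {set 'I_n}}),
    P [set w | [set [set s i | i in A] | A : {set 'I_n} in Pi n w]%SET = pi] =
    P [set w | Pi n w = pi].

(* Only the values of q at nonempty sequences of positive integers matter. *)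
Definition symmetric_function (q : seq nat -> R) :=
  forall s t : seq nat, all (ltn 0) s -> perm_eq s t -> q s = q t.

Definition has_eppf d (Omega : measurableType d) (P : probability Omega R)
    (Pi : forall n, Omega -> {set {set 'I_n}}) (q : seq nat -> R) :=
  symmetric_function q /\
  forall n (pi : {set {set 'I_n}}), (0 < n)%N ->
    finset.partition pi [set: 'I_n]%SET ->
    P [set w | Pi n w = pi] = (q (block_sizes pi))%:E.

Definition is_eppf (q : seq nat -> R) :=
  exists (d : measure_display) (Omega : measurableType d)
         (P : probability Omega R) (Pi : forall n, Omega -> {set {set 'I_n}}),
    [/\ random_partition Pi, exchangeable P Pi & has_eppf P Pi q].

(* q and the law of the random ranked weights (p_j) are associated by Kingman's
   correspondence: an exchangeable partition with EPPF q has a.s. limiting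
   ranked relative block sizes, with the law of (p_j). *)
Definition kingman d (Omega : measurableType d) (P : probability Omega R)
    (q : seq nat -> R) (p : nat -> {RV P >-> R}) :=
  exists (d' : measure_display) (Omega' : measurableType d')
         (P' : probability Omega' R) (Pi : forall n, Omega' -> {set {set 'I_n}})
         (f : nat -> {RV P' >-> R}),
    [/\ random_partition Pi, exchangeable P' Pi, has_eppf P' Pi q,
        {ae P', forall w, forall j,
           (fun n => (ranked_block_size (Pi n w) j)%:R / n%:R : R) @ \oo
           --> f j w}
      & eq_law P' P (trajectory f) (trajectory p)].

End random_partitions.

Section species_sampling.
Context (R : realType).

(* Zeros are not counted: when infinitely many p_j are positive, their
   decreasing rearrangement does not contain the null ones. *)
Definition decreasing_rearrangement (r p : nat -> R) :=
  [/\ {homo r : i j / (i <= j)%N >-> j <= i},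
      forall j, 0 <= r j
    & forall x, 0 < x -> ([set j | r j = x] #= [set j | p j = x])%card].

(* mu is the random probability measure given which (xi_n) is i.i.d.; Q is a
   copy of it of the form \sum_j p_j \delta_(Z_j), possibly on another
   probability space. *)
Definition gSSS d d' (Omega : measurableType d) (T : measurableType d')
    (P : probability Omega R) (q : seq nat -> R) (H : probability T R)
    (xi : nat -> {RV P >-> T}) :=
  exists mu : {RV P >-> pprobability T R},
  conditionally_iid xi mu /\
  exists (d0 : measure_display) (Omega0 : measurableType d0)
         (P0 : probability Omega0 R)
         (p : nat -> {RV P0 >-> R}) (Z : nat -> {RV P0 >-> T})
         (Q : {RV P0 >-> pprobability T R}) (r : nat -> {RV P0 >-> R}),
    [/\ [/\ forall j w, 0 <= p j w <= 1,
            {ae P0, forall w, (\sum_(0 <= j <oo) (p j w)%:E = 1)%E},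
            iid Z H
          & independent2 P0 (trajectory p) (trajectory Z)],
        {ae P0, forall w, forall A : set T, measurable A ->
           ((Q w : probability T R) A =
            \sum_(0 <= j <oo) (p j w)%:E * \d_(Z j w) A)%E},
        eq_law P P0 mu Q,
        {ae P0, forall w, decreasing_rearrangement (r ^~ w) (p ^~ w)}
      & kingman q r].

(* The sample is cut into consecutive blocks of lengths ms_0, ms_1, ..;
   [reshape_index ms a] is the index of the block that contains position a. *)
Definition Hsharp d (T : measurableType d) (H : probability T R)
    (ms : seq nat) : \bar R :=
  iid_sample_law H [set v : (sumn ms).-tuple T |
    forall a b : 'I_(sumn ms), tnth v a = tnth v b <->
      reshape_index ms a = reshape_index ms b].

Context (k : nat) (ns : 'I_k -> nat).

Notation mvec := {dffun forall i : 'I_k, 'I_(ns i).+1}.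

(* The component l i j, for j counted from 0, is \lambda_(i,j+1). *)
Notation lvec :=
  {dffun forall i : 'I_k, {ffun 'I_(ns i) -> 'I_(ns i).+1}}.

Definition Mset : {set mvec} := [set m : mvec | [forall i, (0 < m i)%N]]%SET.

(* The bound l i j <= n_i in the type lvec follows from the first equation. *)
Definition Lambda (m : mvec) : {set lvec} :=
  [set l : lvec | [forall i,
     (\sum_(j < ns i) j.+1 * l i j == ns i)%N &&
     (\sum_(j < ns i) l i j == m i)%N]]%SET.

Definition coefc (l : lvec) : R :=
  \prod_(i < k) ((ns i)`!%:R /
    \prod_(j < ns i) ((l i j)`!%:R * (j.+1)`!%:R ^+ l i j)).

(* The array (n_ic) whose i-th row lists l i 0 times 1, then l i 1 times 2,
   and so on; see [qtilde_array] for the other arrays. *)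
Definition qtilde (q : seq nat -> R) (l : lvec) : R :=
  q (flatten [seq flatten [seq nseq (l i j) j.+1 | j : 'I_(ns i)] | i : 'I_k]).

Lemma qtilde_array (q : seq nat -> R) (l : lvec) (a : 'I_k -> seq nat) :
  symmetric_function q ->
  (forall i, all (ltn 0) (a i)) -> (forall i, sumn (a i) = ns i) ->
  (forall i (j : 'I_(ns i)), count_mem j.+1 (a i) = l i j) ->
  q (flatten [seq a i | i : 'I_k]) = qtilde q l.
Proof.
move=> qsym a_gt0 suma cnta; apply: qsym.
  by rewrite /image_mem; elim: (enum 'I_k) => //= i s IHs; rewrite all_cat a_gt0.
have pcat (I : Type) (s : seq I) (f g : I -> seq nat) :
    (forall i, perm_eq (f i) (g i)) ->
    perm_eq (flatten [seq f i | i <- s]) (flatten [seq g i | i <- s]).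
  by move=> fg; elim: s => //= i s; apply: perm_cat.
apply: (pcat) => i; apply/allP => v _ /=; apply/eqP.
have cntb : count_mem v (flatten [seq nseq (l i j) j.+1 | j : 'I_(ns i)]) =
    (\sum_(j < ns i | j.+1 == v) l i j)%N.
  rewrite count_flatten -map_comp sumnE big_map [LHS]big_enum /=.
  rewrite [RHS]big_mkcond /=; apply: eq_bigr => j _.
  by rewrite count_nseq /=; case: eqP => _; rewrite ?mul1n ?mul0n.
rewrite cntb; case: v {cntb} => [|v].
  rewrite big_pred0 //; apply/count_memPn/negP => v0.
  by have /allP/(_ _ v0) := a_gt0 i.
case: (ltnP v (ns i)) => [v_lt|ns_le].
  rewrite (bigD1 (Ordinal v_lt)) //= big1 ?addn0 ?(cnta i (Ordinal v_lt)) //.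
  by move=> j /andP[/eqP[jv]] /eqP[]; apply/val_inj.
rewrite big_pred0; last first.
  by move=> j; apply/negbTE/eqP => -[jv]; have := ltn_ord j; rewrite jv ltnNge ns_le.
apply/count_memPn/negP => v_in; move: ns_le; rewrite leqNgt => /negP; apply.
by rewrite -(suma i) (perm_sumn (perm_to_rem v_in)) /= leq_addr.
Qed.

End species_sampling.

(* Main.v *)
Require Import Defs.
From HB Require Import structures.
From mathcomp Require Import all_boot all_order all_algebra all_fingroup.
From mathcomp Require Import reals ring lra zify.

(** Given the random measure, [xi_0, .., xi_(n-1)] are atoms [Z_(j_0), ..,
    Z_(j_(n-1))] whose indices are drawn independently with the probabilities
    [p_k], and the weights [p] are independent of the atoms [Z].  So the law of
    the first [n] observations is the mixture, over index vectors [j], of the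
    laws of [(Z_(j_i))_i], with coefficients [E (\prod_i p_(j_i))]
    ([mixture_limit]).  Apply this to the event that the observations coincide
    exactly along [pi].  Let [S] be the partition of [{0, .., n-1}] into the
    level sets of [j].  Distinct indices carry independent draws from [H], so
    the event has probability [H#(m)] when [S] refines [pi] with [m_i] blocks
    inside the [i]-th block of [pi] ([sample_pattern_refines]), and probability
    0 otherwise.  The coefficients of all [j] with level sets [S] add up to
    [q(S)] ([index_partition_limit]).  Hence the probability is the sum over
    the refinements [S] of [pi] of [H#(m) q(S)]; since [c(lambda)] counts the
    refinements with block sizes [lambda] ([card_partitions_of_type]),
    collecting them by [m] and [lambda] gives the formula ([sum_refinements]).

    That the coefficients add up to [q(S)] is Kingman's paintbox formula for
    weights of total mass one.  It is enough to compare the sums of both sides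
    over the partitions coarser than a given [rho] ([upper_refinements_in]).
    For the coefficients this sum is the expectation of the product, over the
    blocks [B] of [rho], of the power sums [\sum_k p_k ^ #|B|]
    ([prod_power_sums]).  For [q] it is the probability that an exchangeable
    partition [Pi] with EPPF [q] splits no block of [rho].  By exchangeability
    the elements [0, .., n-1] may be replaced by any [n] distinct elements of
    [{0, .., N-1}]; averaging over samples with replacement, which are distinct
    up to a vanishing proportion, yields the expectation of the same product of
    power sums for the relative block sizes of [Pi_N]
    ([sampling_with_replacement]).  When [N] grows, these sizes converge to
    frequencies with the law of the ranked weights.  As the frequencies have
    total mass one, no mass is lost in the limit and the power sums converge
    too ([scheffe]).

    Sums over all indices are limits of sums over the indices below [K], so
    that products of sums can be expanded as finite sums. *)

Set Implicit Arguments.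
Unset Strict Implicit.
Unset Printing Implicit Defensive.
Import Order.TTheory GRing.Theory Num.Theory.
Local Open Scope ring_scope.

(** * Counting set partitions by block sizes *)

Section counting.
Context (T : finType) (N : nat).
Implicit Types (A B : {set T}) (P : {set {set T}}) (l : 'I_N -> nat).

(** As for the vectors [lambda] of the theorem, the entry [l j] is the number
    of blocks of size [j.+1]. *)
Definition has_type P l :=
  [forall j : 'I_N, #|[set B in P | #|B| == j.+1]%SET| == l j].

Definition partitions_of_type A l :=
  [set P : {set {set T}} | partition P A && has_type P l]%SET.

Definition one_block_less l (b : 'I_N) : 'I_N -> nat := fun j => (l j - (j == b))%N.

(** Removing [B] is a bijection onto the partitions of the rest of [A]. *)
Lemma card_partitions_with_block A B l (b : 'I_N) :
  B \subset A -> #|B| = b.+1 -> (0 < l b)%N ->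
  #|[set P in partitions_of_type A l | B \in P]%SET| =
  #|partitions_of_type (A :\: B)%SET (one_block_less l b)|.
Proof.
move=> BA cB lb.
have B0 : B != set0 by rewrite -card_gt0 cB.
have disjB P : partition P (A :\: B)%SET -> B \notin P.
  move=> pP; apply/negP => BP; move/set0Pn: B0 => -[x xB].
  by move/(subsetP (partitionS pP BP)): (xB); rewrite in_setD xB.
have cnt P j : B \notin P -> #|[set C in (B |: P) | #|C| == j.+1]%SET| =
     ((j == b) + #|[set C in P | #|C| == j.+1]%SET|)%N.
  move=> BP; case: eqP => [->|jb].
    have := cardsU1 B [set C in P | #|C| == b.+1]%SET.
    rewrite inE (negbTE BP) /= => <-; apply: eq_card => C.
    by rewrite !inE; case: eqVneq => [->|//] /=; rewrite cB eqxx.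
  apply: eq_card => C; rewrite !inE; case: eqVneq => [->|//] /=.
  rewrite cB (negbTE BP)/= eqSS; apply/negbTE; apply: contra_notN jb.
  by move=> /eqP.
have -> : [set P in partitions_of_type A l | B \in P]%SET =
    [set B |: P | P in partitions_of_type (A :\: B)%SET (one_block_less l b)]%SET.
  apply/setP => P; apply/idP/imsetP.
    rewrite !inE => /andP[/andP[pP /forallP tP] BP].
    exists (P :\ B)%SET; last by rewrite setD1K.
    rewrite inE partitionD1//=; apply/forallP => j.
    have := tP j; rewrite -{1}(setD1K BP) cnt ?inE ?eqxx//.
    by rewrite /one_block_less -val_eqE => /eqP <-; rewrite addKn.
  move=> [Q Qin ->]; rewrite inE in Qin; case/andP: Qin => pQ /forallP tQ.
  have BQ := disjB _ pQ.
  rewrite !inE eqxx/= andbT; apply/andP; split.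
    have -> : A = (B :|: (A :\: B))%SET.
      by rewrite setDE setUIr setUCr setIT; apply/esym/setUidPr.
    apply: partitionU1 => //; by apply/pred0P => y; rewrite /= !inE; case: (y \in B).
  apply/forallP => j; rewrite cnt// (eqP (tQ j)) /one_block_less val_eqE.
  by have [->|_] := eqVneq j b; rewrite ?subn0 ?subnKC.
rewrite card_in_imset// => P Q; rewrite !inE => /andP[/disjB BP _] /andP[/disjB BQ _] PQ.
by rewrite -(setU1K BP) PQ setU1K.
Qed.

(** The number of permutations of the elements of [A] that fix a given
    partition of type [l], so that the partitions of type [l], an orbit of the
    symmetric group, are [#|A|`!] divided by it. *)
Definition type_weight l := (\prod_(j < N) ((l j)`! * j.+1`! ^ l j))%N.

Lemma type_weight_less l b : (0 < l b)%N ->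
  type_weight l = (type_weight (one_block_less l b) * (l b * b.+1`!))%N.
Proof.
move=> lb; rewrite /type_weight (bigD1 b)//= [in RHS](bigD1 b)//=.
rewrite (eq_bigr (fun j : 'I_N => (one_block_less l b j)`! * j.+1`! ^ one_block_less l b j)%N).
  rewrite /one_block_less eqxx; case: (l b) lb => // u _; rewrite subn1 /=.
  by rewrite factS expnS; ring.
by move=> j /negbTE jb; rewrite /one_block_less jb subn0.
Qed.

Lemma card_subsets_containing A x b : x \in A ->
  #|[set B : {set T} | [&& B \subset A, x \in B & #|B| == b.+1]]%SET| =
  'C(#|A|.-1, b).
Proof.
move=> xA; have -> : #|A|.-1 = #|(A :\ x)%SET| by rewrite (cardsD1 x A) xA.
rewrite -cards_draws -[RHS](card_in_imset (f := fun D => x |: D)%SET); last first.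
  move=> D E; rewrite !inE => /andP[/subsetD1P[_ xD] _] /andP[/subsetD1P[_ xE] _] DE.
  by rewrite -(setU1K xD) DE setU1K.
apply: eq_card => B; rewrite inE; apply/and3P/imsetP => [[BA xB cB]|[D]].
  exists (B :\ x)%SET; last by rewrite setD1K.
  rewrite !inE setSD//=; move: cB; rewrite (cardsD1 x B) xB.
  by rewrite add1n eqSS.
rewrite !inE => /andP[/subsetD1P[DA xD] /eqP cD] ->; split.
- by rewrite subUset sub1set xA.
- by rewrite !inE eqxx.
- by rewrite cardsU1 xD cD.
Qed.

(** Induction on [#|A|], according to the block [B] of a fixed element [x].
    There are ['C(#|A|.-1, b)] choices of [B] with [b.+1] elements; multiplied
    by the weight, each of them contributes
    [(#|A| - b.+1)`! * (l b * b.+1`!)], in total [#|A|.-1`! * (b.+1 * l b)].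
    The sum over [b] is [#|A|.-1`! * #|A|]. *)
Theorem card_partitions_of_type A l : (#|A| <= N)%N ->
  (\sum_(j < N) j.+1 * l j = #|A|)%N ->
  (#|partitions_of_type A l| * type_weight l = #|A|`!)%N.
Proof.
have [m] := ubnP #|A|; elim: m A l => // m IHm A l; rewrite ltnS => Am AN suml.
have [A0|[x xA]] := set_0Vmem A.
  have l0 j : l j = 0%N.
    move/eqP: suml; rewrite A0 cards0 sum_nat_eq0 => /forallP/(_ j)/=.
    by rewrite muln_eq0 => /eqP.
  rewrite A0 cards0 /type_weight big1 ?muln1 => [|j _]; last by rewrite l0.
  rewrite -[RHS](cards1 (set0 : {set {set T}})); apply: eq_card => P.
  rewrite !inE partition_set0; case: eqP => //= ->.
  apply/forallP => j; rewrite l0; apply/eqP/eqP; rewrite cards_eq0.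
  by apply/eqP/setP => B; rewrite !inE.
have A0 : (0 < #|A|)%N by apply/card_gt0P; exists x.
have le_l (b : 'I_N) : (b.+1 * l b <= #|A|)%N by rewrite -suml (bigD1 b)//= leq_addr.
have step B (b : 'I_N) : B \subset A -> x \in B -> #|B| = b.+1 ->
    (#|[set P in partitions_of_type A l | B \in P]%SET| * type_weight l =
     (#|A| - b.+1)`! * (l b * b.+1`!))%N.
  move=> BA xB cB; have [lb0|lb] := posnP (l b).
    rewrite lb0 mul0n muln0; apply/eqP; rewrite muln_eq0 cards_eq0.
    apply/orP; left; apply/eqP/setP => P; rewrite !inE.
    apply/negbTE/negP => /andP[/andP[_ /forallP/(_ b)]].
    rewrite lb0 cards_eq0 => /eqP/setP/(_ B); rewrite !inE cB eqxx andbT.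
    by move=> ->.
  have cAB : #|(A :\: B)%SET| = (#|A| - b.+1)%N by rewrite cardsDS// cB.
  rewrite (card_partitions_with_block BA cB lb) (type_weight_less lb) mulnA.
  congr (_ * _)%N; rewrite -cAB; apply: IHm.
  - by rewrite cAB; move: Am A0; lia.
  - by rewrite cAB; move: AN; lia.
  - rewrite cAB -suml (bigD1 b)//= [in RHS](bigD1 b)//= /one_block_less eqxx.
    rewrite (eq_bigr (fun j : 'I_N => j.+1 * l j)%N).
      by move: (\sum_(i < N | _) _)%N (le_l b) lb; nia.
    by move=> j /negbTE jb; rewrite jb subn0.
have N0 : (0 < N)%N by apply: leq_trans AN.
have sizeK B : B \subset A -> x \in B ->
    insubd (Ordinal N0) #|B|.-1 = #|B|.-1 :> nat.
  move=> BA xB; rewrite val_insubd ifT//.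
  have B0 : (0 < #|B|)%N by apply/card_gt0P; exists x.
  by have := leq_trans (subset_leq_card BA) AN; lia.
rewrite -sum1_card big_distrl/=.
rewrite (partition_big (fun P => pblock P x)
  (fun B => (B \subset A) && (x \in B))) => [|P]; last first.
  rewrite inE => /andP[pP _].
  have xP : x \in cover P by rewrite (cover_partition pP).
  by rewrite mem_pblock xP (partitionS pP) ?pblock_mem.
(* The default value of insubd is not reached: 0 < #|B| <= N. *)
rewrite (partition_big (fun B => insubd (Ordinal N0) #|B|.-1) predT)//=.
transitivity (\sum_(b < N) #|A|.-1`! * (b.+1 * l b))%N; last first.
  by rewrite -big_distrr/= suml; case: #|A| A0 => // a _; rewrite factS mulnC.
apply: eq_bigr => b _.
transitivity (\sum_(B in [set B : {set T} | [&& B \subset A, x \in B & #|B| == b.+1]]%SET)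
   ((#|A| - b.+1)`! * (l b * b.+1`!)))%N.
  apply: eq_big => [B|B /andP[/andP[BA xB] /eqP Bb]].
    rewrite inE -andbA; case BA: (B \subset A) => //=; case xB: (x \in B) => //=.
    rewrite -val_eqE/= sizeK//.
    have B0 : (0 < #|B|)%N by apply/card_gt0P; exists x.
    by case: #|B| B0.
  have cB : #|B| = b.+1.
    have B0 : (0 < #|B|)%N by apply/card_gt0P; exists x.
    by rewrite -Bb sizeK// prednK.
  rewrite -(step _ _ BA xB cB) -sum1_card big_distrl/=; apply: eq_bigl => P.
  rewrite !inE; case pP : (partition P A) => //=; case tP : (has_type P l) => //=.
  apply/eqP/idP => [<-|BP]; last exact: def_pblock (partition_trivIset pP) BP xB.
  by rewrite pblock_mem// (cover_partition pP).
rewrite sum_nat_const card_subsets_containing//.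
have [bA|Ab] := leqP b.+1 #|A|.
  rewrite -(@bin_fact #|A|.-1 b) ?factS; last by lia.
  by rewrite (_ : (#|A| - b.+1 = #|A|.-1 - b)%N); [ring|lia].
have -> : l b = 0%N by have := le_l b; nia.
by rewrite !(muln0, mul0n).
Qed.

End counting.

(** * Refinements of a partition *)

Section refines.
Context (n : nat).
Implicit Types (P : {set {set 'I_n}}) (B : {set 'I_n}).

(** Constancy of a labelling [c] on the blocks of [P] expresses three
    conditions at once: [P] refines the partition with block index [c], the
    level sets of an index vector [c] are coarser than [P], and, for
    [c = pblock Q], [Q] is coarser than [P]. *)
Definition refines (J : eqType) (c : 'I_n -> J) P :=
  [forall x, forall y, (y \in pblock P x) ==> (c x == c y)].

Lemma refinesP (J : eqType) (c : 'I_n -> J) P x B y :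
  partition P [set: 'I_n]%SET -> refines c P -> B \in P ->
  x \in B -> y \in B -> c x = c y.
Proof.
move=> pP /forallP/(_ x)/forallP/(_ y)/implyP rP BP xB yB; apply/eqP/rP.
by rewrite (def_pblock (partition_trivIset pP) BP xB).
Qed.

Lemma partition_mem P x : partition P [set: 'I_n]%SET -> exists2 B, B \in P & x \in B.
Proof.
move=> pP; have xP : x \in cover P by rewrite (cover_partition pP).
by exists (pblock P x); [exact: pblock_mem|rewrite mem_pblock].
Qed.

End refines.

Section refinement.
Context (n k : nat) (c : 'I_n -> 'I_k).
Implicit Types (P : {set {set 'I_n}}) (B : {set 'I_n}) (i : 'I_k).

Definition fibre i : {set 'I_n} := [set x | c x == i]%SET.

Definition blocks_in P i : {set {set 'I_n}} := [set B in P | B \subset fibre i]%SET.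

Let setT := [set: 'I_n]%SET.

Lemma mem_blocks_in P i B x : partition P setT -> refines c P -> x \in B ->
  (B \in blocks_in P i) = (B \in P) && (c x == i).
Proof.
move=> pP rP xB; rewrite inE; case BP : (B \in P) => //=; apply/idP/eqP.
  by move/subsetP/(_ x xB); rewrite inE => /eqP.
move=> ci; apply/subsetP => y yB; rewrite inE -ci; apply/eqP.
exact: (refinesP pP rP BP yB xB).
Qed.

Lemma blocks_in_partition P i : partition P setT -> refines c P ->
  partition (blocks_in P i) (fibre i).
Proof.
move=> pP rP; have [/eqP cP tP P0] := and3P pP; apply/and3P; split.
- rewrite eqEsubset; apply/andP; split; apply/subsetP => x.
    by case/bigcupP => B; rewrite inE => /andP[_ /subsetP]; exact.
  have [B BP xB] := partition_mem x pP.
  rewrite inE => cx; apply/bigcupP; exists B => //.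
  by rewrite (mem_blocks_in i pP rP xB) BP.
- by apply: trivIsetS tP; apply/subsetP => B; rewrite inE => /andP[].
- by rewrite inE (negbTE P0).
Qed.

Lemma perm_blocks_in P : partition P setT -> refines c P ->
  perm_eq (flatten [seq enum (blocks_in P i) | i : 'I_k]) (enum P).
Proof.
move=> pP rP; apply/allP => B _ /=; apply/eqP.
rewrite count_flatten -map_comp sumnE big_map big_enum/=.
rewrite [in RHS]count_uniq_mem ?enum_uniq// mem_enum.
under eq_bigr do rewrite count_uniq_mem ?enum_uniq// mem_enum.
have [BP|BP] := boolP (B \in P); last first.
  by rewrite big1// => i _; rewrite inE (negbTE BP).
have /set0Pn[x xB] := partition_neq0 pP BP.
rewrite (bigD1 (c x))//= (mem_blocks_in _ pP rP xB) BP eqxx big1 ?addn0// => i.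
by rewrite (mem_blocks_in _ pP rP xB) eq_sym => /negbTE ->; rewrite andbF.
Qed.

Lemma blocks_in_inj P Q : partition P setT -> refines c P ->
  partition Q setT -> refines c Q ->
  (forall i, blocks_in P i = blocks_in Q i) -> P = Q.
Proof.
move=> pP rP pQ rQ PQ; apply/setP => B.
have [->|/set0Pn[x xB]] := eqVneq B set0.
  by rewrite (partition0 pP) (partition0 pQ).
have := mem_blocks_in (c x) pP rP xB; have := mem_blocks_in (c x) pQ rQ xB.
by rewrite PQ eqxx !andbT => <-.
Qed.

(** Together with [blocks_in_inj], this makes a refinement the same thing as
    an independent choice of a partition of each fibre. *)
Lemma glue_partitions (F : 'I_k -> {set {set 'I_n}}) :
  (forall i, partition (F i) (fibre i)) ->
  [/\ partition (\bigcup_i F i)%SET setT, refines c (\bigcup_i F i)%SET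
    & forall i, blocks_in (\bigcup_i F i)%SET i = F i].
Proof.
move=> pF; have FE i B x : B \in F i -> x \in B -> c x = i.
  by move=> BF /(subsetP (partitionS (pF i) BF)); rewrite inE => /eqP.
have pP : partition (\bigcup_i F i)%SET setT.
  apply/and3P; split.
  - apply/eqP/setP => x; rewrite !inE; have := cover_partition (pF (c x)).
    move=> /setP/(_ x); rewrite [RHS]inE eqxx => /bigcupP[B BF xB].
    by apply/bigcupP; exists B => //; apply/bigcupP; exists (c x).
  - apply/trivIsetP => A B /bigcupP[i _ AF] /bigcupP[j _ BF] AB.
    have [ij|ij] := eqVneq i j.
      rewrite -ij in BF.
      exact: (trivIsetP (partition_trivIset (pF i))).
    apply/pred0P => x /=; apply/negP => /andP[xA xB].
    by case/eqP: ij; rewrite -(FE _ _ _ AF xA) -(FE _ _ _ BF xB).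
  - by apply/negP => /bigcupP[i _]; rewrite (partition0 (pF i)).
have rP : refines c (\bigcup_i F i)%SET.
  apply/forallP => x; apply/forallP => y; apply/implyP.
  have [B BP xB] := partition_mem x pP.
  rewrite (def_pblock (partition_trivIset pP) BP xB) => yB.
  have /bigcupP[i _ BF] := BP.
  by rewrite (FE _ _ _ BF xB) (FE _ _ _ BF yB).
split=> // i; apply/setP => B; rewrite inE; apply/andP/idP => [[/bigcupP[j _ BF]]|BF].
  have /set0Pn[x xB] := partition_neq0 (pF j) BF.
  by move=> /subsetP/(_ x xB); rewrite inE (FE _ _ _ BF xB) => /eqP <-.
by split; [apply/bigcupP; exists i|exact: partitionS (pF i) BF].
Qed.

Lemma card_refinements_of_type (N : 'I_k -> nat) (l : forall i, 'I_(N i) -> nat) :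
  #|[set P | [&& partition P setT, refines c P &
       [forall i, blocks_in P i \in partitions_of_type (fibre i) (@l i)]]]%SET| =
  (\prod_i #|partitions_of_type (fibre i) (@l i)|)%N.
Proof.
pose G i := partitions_of_type (fibre i) (@l i).
transitivity #|family (fun i => mem (G i))|; last first.
  by rewrite card_family foldrE big_map big_enum; apply: eq_bigr.
pose tr P := [ffun i => blocks_in P i].
rewrite -(card_in_imset (f := tr)); last first.
  move=> P Q; rewrite !inE => /and3P[pP rP _] /and3P[pQ rQ _] /ffunP PQ.
  by apply: blocks_in_inj => // i; have := PQ i; rewrite !ffunE.
apply: eq_card => F; apply/imsetP/familyP => [[P + ->] i|FG].
  by rewrite inE => /and3P[_ _ /forallP/(_ i)]; rewrite ffunE.
have pF i : partition (F i) (fibre i).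
  by have := FG i; rewrite /G !inE => /andP[].
have [pP rP bP] := glue_partitions pF.
exists (\bigcup_i F i)%SET; last by apply/ffunP => i; rewrite ffunE bP.
by rewrite inE pP rP; apply/forallP => i; rewrite bP; exact: FG.
Qed.

End refinement.

Section regroup.
Context (R : realType) (n k : nat) (c : 'I_n -> 'I_k) (ns : 'I_k -> nat).
Hypothesis card_fibre : forall i, #|fibre c i| = ns i.
Hypothesis ns_gt0 : forall i, (0 < ns i)%N.
Implicit Types (P : {set {set 'I_n}}).

Local Notation mvec := {dffun forall i : 'I_k, 'I_(ns i).+1}.
Local Notation lvec :=
  {dffun forall i : 'I_k, {ffun 'I_(ns i) -> 'I_(ns i).+1}}.
Let setT := [set: 'I_n]%SET.

Lemma sum_card_by_size (Q : {set {set 'I_n}}) (A : {set 'I_n}) N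
    (F : nat -> nat) : partition Q A -> (#|A| <= N)%N ->
  (\sum_(j < N) F j.+1 * #|[set B in Q | #|B| == j.+1]%SET| =
   \sum_(B in Q) F #|B|)%N.
Proof.
move=> pQ AN; rewrite [RHS](partition_big (fun B : {set 'I_n} => inord #|B| : 'I_N.+1) predT)//=.
have sz B : B \in Q -> (0 < #|B| <= N)%N.
  move=> BQ; rewrite card_gt0 (partition_neq0 pQ)//=.
  by apply: leq_trans AN; apply/subset_leq_card/(partitionS pQ).
rewrite [RHS]big_ord_recl/= [X in _ = (X + _)%N]big1 ?add0n => [|B /andP[BQ]]; last first.
  have /andP[B0 BN] := sz _ BQ.
  by move=> /eqP/(congr1 val); rewrite /= inordK// => B0'; rewrite B0' in B0.
apply: eq_bigr => j _; rewrite mulnC -sum_nat_const; apply: eq_big => B.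
  rewrite inE; case BQ : (B \in Q) => //=; have /andP[_ BN] := sz _ BQ.
  by rewrite -val_eqE/= inordK.
by rewrite inE => /andP[_ /eqP ->].
Qed.

Definition multiplicities P : mvec := [ffun i => inord #|blocks_in c P i|].

Definition refinement_type P : lvec :=
  [ffun i => [ffun j : 'I_(ns i) => inord #|[set B in blocks_in c P i | #|B| == j.+1]%SET|]].

Section one_partition.
Variable P : {set {set 'I_n}}.
Hypotheses (pP : partition P setT) (rP : refines c P).

Lemma card_blocks_in_le i : (#|blocks_in c P i| < (ns i).+1)%N.
Proof.
have pB := blocks_in_partition i pP rP.
rewrite ltnS -(card_fibre i) (card_partition pB) -sum1_card.
by apply: leq_sum => B BP; rewrite card_gt0 (partition_neq0 pB).
Qed.

Lemma multiplicitiesE i : multiplicities P i = #|blocks_in c P i| :> nat.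
Proof. by rewrite ffunE inordK// card_blocks_in_le. Qed.

Lemma refinement_typeE i j :
  refinement_type P i j = #|[set B in blocks_in c P i | #|B| == j.+1]%SET| :> nat.
Proof.
rewrite !ffunE inordK//; apply: leq_ltn_trans (card_blocks_in_le i).
by apply/subset_leq_card/subsetP => B; rewrite inE => /andP[].
Qed.

Lemma multiplicities_gt0 i : (0 < multiplicities P i)%N.
Proof.
rewrite multiplicitiesE lt0n; apply/negP; rewrite cards_eq0 => /eqP B0.
have := cover_partition (blocks_in_partition i pP rP).
rewrite B0 /cover big_set0 => /(congr1 (fun A : {set _} => #|A|)).
by rewrite cards0 card_fibre => e; have := ns_gt0 i; rewrite -e.
Qed.

Lemma refinement_type_Lambda : refinement_type P \in Lambda (multiplicities P).
Proof.
rewrite inE; apply/forallP => i; have pB := blocks_in_partition i pP rP.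
have le : (#|fibre c i| <= ns i)%N by rewrite card_fibre.
under eq_bigr do rewrite refinement_typeE.
under [X in _ && (X == _)]eq_bigr do rewrite refinement_typeE -[#|_|]mul1n.
rewrite (sum_card_by_size id pB le) -(card_partition pB) card_fibre eqxx/=.
by rewrite (sum_card_by_size (fun=> 1%N) pB le) sum1_card multiplicitiesE.
Qed.

Lemma eppf_refinement_type (q : seq nat -> R) : symmetric_function q ->
  q (block_sizes P) = qtilde q (refinement_type P).
Proof.
move=> qsym; pose a i := [seq #|B| | B : {set 'I_n} <- enum (blocks_in c P i)].
have gt0 (s : seq {set 'I_n}) : {subset s <= P} -> all (ltn 0) [seq #|B| | B : {set 'I_n} <- s].
  move=> sP; apply/allP => _ /mapP[B /sP BP ->].
  by rewrite /= card_gt0 (partition_neq0 pP).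
have bP i : {subset enum (blocks_in c P i) <= P}.
  by move=> B; rewrite mem_enum inE => /andP[].
rewrite -(@qtilde_array _ _ _ q _ a) => //.
- apply: qsym.
    by apply: gt0 => B; rewrite mem_sort mem_enum.
  rewrite /block_sizes perm_sym /image_mem /a.
  rewrite (map_comp (fun s : seq {set 'I_n} => [seq #|B| | B : {set 'I_n} <- s])).
  rewrite -map_flatten; apply: perm_map; rewrite perm_sym /blocks perm_sort perm_sym.
  exact: perm_blocks_in.
- by move=> i; apply: gt0 => B /bP.
- move=> i; rewrite sumnE big_map big_enum/=.
  by rewrite -(card_partition (blocks_in_partition i pP rP)).
- move=> i j; rewrite refinement_typeE count_map -size_filter cardE; congr size.
  rewrite /enum_mem -filter_predI; apply: eq_filter => B.
  by rewrite /= !inE andbC.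
Qed.

End one_partition.

Lemma coefc_card (m : mvec) (l : lvec) : l \in Lambda m ->
  #|[set P | [&& partition P setT, refines c P &
       [forall i, blocks_in c P i \in
         partitions_of_type (fibre c i) (fun j => l i j)]]]%SET|%:R = coefc R l.
Proof.
rewrite inE => /forallP lm; rewrite card_refinements_of_type natr_prod.
apply: eq_bigr => i _; have /andP[/eqP sl _] := lm i.
have W0 : (\prod_(j < ns i) ((l i j)`!%:R * (j.+1)`!%:R ^+ l i j) : R) =
    (type_weight (fun j => l i j))%:R.
  by rewrite natr_prod; apply: eq_bigr => j _; rewrite natrM natrX.
have := @card_partitions_of_type _ (ns i) (fibre c i) (fun j => l i j).
rewrite W0 card_fibre leqnn => /(_ isT sl) <-.
rewrite natrM mulfK// pnatr_eq0 -lt0n prodn_gt0// => j.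
by rewrite muln_gt0 fact_gt0 expn_gt0 fact_gt0.
Qed.

(** The weight [h] depends on a refinement through the number of its blocks in
    each fibre, and [q] through its block sizes; so all the refinements of a
    given type contribute equally, and [coefc_card] counts them. *)
Theorem sum_refinements (q : seq nat -> R) (h : mvec -> R) :
  symmetric_function q ->
  \sum_(P | partition P setT && refines c P) h (multiplicities P) * q (block_sizes P) =
  \sum_(m in Mset ns) h m * \sum_(l in Lambda m) coefc R l * qtilde q l.
Proof.
move=> qsym.
rewrite (partition_big multiplicities (fun m => m \in Mset ns)) => [|P /andP[pP rP]]; last first.
  by rewrite inE; apply/forallP => i; exact: multiplicities_gt0.
apply: eq_bigr => m mM; rewrite big_distrr/=.
rewrite (partition_big refinement_type (fun l => l \in Lambda m)); last first.
  by move=> P /andP[/andP[pP rP] /eqP <-]; exact: refinement_type_Lambda.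
apply: eq_bigr => l lm; rewrite mulrA -(coefc_card lm).
transitivity (\sum_(P in [set P | [&& partition P setT, refines c P &
       [forall i, blocks_in c P i \in
         partitions_of_type (fibre c i) (fun j => l i j)]]]%SET) h m * qtilde q l).
  apply: eq_big => [P|P /andP[/andP[/andP[pP rP] /eqP <-] /eqP <-]]; last first.
    by rewrite eppf_refinement_type.
  rewrite inE; case pP : (partition P setT) => //=.
  case rP : (refines c P) => //=.
  have E : [forall i, blocks_in c P i \in
         partitions_of_type (fibre c i) (fun j => l i j)] = (refinement_type P == l).
    apply/forallP/eqP => [lP|<- i].
      apply/ffunP => i; apply/ffunP => j; apply/val_inj; rewrite /= refinement_typeE//.
      by have := lP i; rewrite inE => /andP[_ /forallP/(_ j)/eqP].
    rewrite inE blocks_in_partition//=; apply/forallP => j.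
    by rewrite refinement_typeE.
  rewrite E; case: (eqVneq (refinement_type P) l) => [sl|_]; rewrite ?andbF// andbT.
  apply/eqP/ffunP => i; apply/val_inj => /=.
  have := refinement_type_Lambda pP rP; move: lm; rewrite sl !inE => /forallP/(_ i)/andP[_ /eqP <-].
  by move=> /forallP/(_ i)/andP[_ /eqP <-].
by rewrite sumr_const -mulr_natl; ring.
Qed.

End regroup.

(** * Sums over coarser partitions *)

Section upper_sums.
Context (V : zmodType) (S : V -> Prop) (I T : finType) (D : pred I) (E : I -> {set T}).
Hypotheses (S0 : S 0) (SB : forall x y, S x -> S y -> S (x - y)).

(** Triangularity: the sum over the sets above [E i] is [a i] plus terms with
    strictly larger sets, so [a i] is recovered from the upper sums by
    subtraction, by induction on the codimension of [E i].  The statement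
    concerns a subgroup [S] of values so that it applies to the sequences that
    tend to 0, which compares limits before their existence is known. *)
Lemma upper_sums_in (a : I -> V) : {in D &, injective E} ->
  (forall i, D i -> S (\sum_(j | D j && (E i \subset E j)) a j)) ->
  forall i, D i -> S (a i).
Proof.
move=> Einj Sa i Di; have [m] := ubnP (#|T| - #|E i|).
elim: m i Di => // m IHm i Di; rewrite ltnS => im.
have := Sa i Di; rewrite (bigD1 i)/=; last by rewrite subxx andbT.
set s := \sum_(_ | _) _; suff Ss : S s by move=> /SB/(_ Ss); rewrite addrK.
rewrite /s; apply: (big_ind S) => // [x y Sx Sy|j /andP[/andP[Dj ij] ji]].
  by rewrite -[y]opprK; apply: SB => //; rewrite -sub0r; exact: SB.
apply: IHm => //; have /proper_card ltE : E i \proper E j.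
  rewrite properEneq ij andbT; apply: contra ji => /eqP ij'.
  by apply/eqP/Einj.
by apply: leq_trans im; rewrite ltn_sub2l// (leq_trans ltE)// max_card.
Qed.

End upper_sums.

Section kernels.
Context (n : nat).
Implicit Types (P Q : {set {set 'I_n}}).
Let setT := [set: 'I_n]%SET.

(** The equivalence relation as a set of pairs: partitions get coarser exactly
    when this set gets larger. *)
Definition same_block P : {set 'I_n * 'I_n} :=
  [set z | pblock P z.1 == pblock P z.2]%SET.

Lemma mem_same_pblock P x y : partition P setT ->
  (y \in pblock P x) = (pblock P x == pblock P y).
Proof.
move=> pP; rewrite eq_pblock ?(partition_trivIset pP)//.
by rewrite (cover_partition pP) inE.
Qed.

Lemma same_block_inj P Q : partition P setT -> partition Q setT ->
  same_block P = same_block Q -> P = Q.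
Proof.
move=> pP pQ PQ; rewrite -(equivalence_partition_pblock pP).
rewrite -(equivalence_partition_pblock pQ); apply: eq_imset => x.
apply/setP => y; rewrite !inE !mem_same_pblock//.
by have /setP/(_ (x, y)) := PQ; rewrite !inE.
Qed.

Lemma refines_same_block P Q : partition P setT ->
  refines (pblock Q) P = (same_block P \subset same_block Q).
Proof.
move=> pP; apply/forallP/subsetP => [rP [x y]|PQ x].
  rewrite !inE/= -mem_same_pblock// => xy.
  by have /forallP/(_ y) := rP x; rewrite xy.
apply/forallP => y; apply/implyP; rewrite mem_same_pblock// => xy.
by have := PQ (x, y); rewrite !inE; exact.
Qed.

Lemma pblock_kernel (J : eqType) (c : 'I_n -> J) x y :
  (pblock (preim_partition c setT) x == pblock (preim_partition c setT) y) =
  (c x == c y).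
Proof.
have pc := preim_partitionP c setT.
rewrite -mem_same_pblock// pblock_equivalence_partition ?inE//.
by split=> // /eqP ->.
Qed.

Lemma refines_kernel (J : eqType) (c : 'I_n -> J) P :
  refines c P = refines (pblock (preim_partition c setT)) P.
Proof.
by apply: eq_forallb => x; apply: eq_forallb => y; rewrite pblock_kernel.
Qed.

Lemma kernel_eq (J : eqType) (c : 'I_n -> J) P : partition P setT ->
  (preim_partition c setT == P) =
  [forall x, forall y, (c x == c y) == (pblock P x == pblock P y)].
Proof.
move=> pP; apply/eqP/forallP => [<- x|cP].
  by apply/forallP => y; rewrite pblock_kernel.
apply: same_block_inj => //; first exact: preim_partitionP.
apply/setP => -[x y]; rewrite !inE pblock_kernel.
exact: (eqP (forallP (cP x) y)).
Qed.

Lemma upper_refinements_in (V : zmodType) (S : V -> Prop) (a : {set {set 'I_n}} -> V) :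
  S 0 -> (forall x y, S x -> S y -> S (x - y)) ->
  (forall P, partition P setT ->
    S (\sum_(Q | partition Q setT && refines (pblock Q) P) a Q)) ->
  forall P, partition P setT -> S (a P).
Proof.
move=> S0 SB Sa.
apply: (upper_sums_in (E := same_block) S0 SB) => [P Q|P pP].
  exact: same_block_inj.
by have := Sa P pP; under eq_bigl do rewrite (refines_same_block _ pP).
Qed.

(** Expanding the product chooses an index for each block of [P], which is a
    labelling of the elements constant on the blocks. *)
Lemma prod_power_sums (R : comPzRingType) (J : finType) (x : J -> R) P :
  J -> partition P setT ->
  \sum_(j : {ffun 'I_n -> J} | refines j P) \prod_i x (j i) =
  \prod_(B in P) \sum_(k : J) x k ^+ #|B|.
Proof.
move=> j0 pP; rewrite (big_distr_big j0).
pose colour (g : {ffun {set 'I_n} -> J}) : {ffun 'I_n -> J} :=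
  [ffun i => g (pblock P i)].
pose block_colour (j : {ffun 'I_n -> J}) : {ffun {set 'I_n} -> J} :=
  [ffun B => if B \in P then if [pick i in B] is Some i then j i else j0 else j0].
have blockP i : pblock P i \in P /\ i \in pblock P i.
  by rewrite mem_pblock pblock_mem (cover_partition pP) inE.
rewrite (reindex_onto colour block_colour)/=; last first.
  move=> j rj; apply/ffunP => i; rewrite !ffunE (blockP i).1.
  case: pickP => [y yi|/(_ i)]; last by rewrite (blockP i).2.
  by rewrite (refinesP pP rj (blockP i).1 yi (blockP i).2).
apply: eq_big => [g|g _]; last first.
  under eq_bigr do rewrite ffunE.
  rewrite (eq_bigl (mem setT)) => [|i]; last by rewrite /= in_setT.
  rewrite (set_partition_big _ pP)/=; apply: eq_bigr => B BP.
  rewrite (eq_bigr (fun=> x (g B))) => [|i iB]; first by rewrite prodr_const.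
  by rewrite (def_pblock (partition_trivIset pP) BP iB).
have -> : refines (colour g) P.
  apply/forallP => u; apply/forallP => v; apply/implyP.
  by rewrite mem_same_pblock// !ffunE => /eqP ->.
apply/eqP/pffun_onP => [<-|[sg _]].
  by split=> //; apply/subsetP => B; rewrite !inE ffunE; case: ifP => //; rewrite eqxx.
apply/ffunP => B; rewrite ffunE; case: ifP => BP.
  have /set0Pn[y yB] := partition_neq0 pP BP.
  case: pickP => [i iB|/(_ y)]; last by rewrite yB.
  by rewrite ffunE (def_pblock (partition_trivIset pP) BP iB).
by apply/esym/eqP; apply: contraFT BP => gB; apply: (subsetP sg).
Qed.

End kernels.

(** * Sampling with and without replacement *)

Section restriction.

Lemma pblock_restrict m n (le_mn : (m <= n)%N) (P : {set {set 'I_n}}) x y :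
  partition P [set: 'I_n]%SET ->
  (pblock (restrict le_mn P) x == pblock (restrict le_mn P) y) =
  (pblock P (widen_ord le_mn x) == pblock P (widen_ord le_mn y)).
Proof.
move=> pP; pose f (u : 'I_m) := pblock P (widen_ord le_mn u).
have tP := partition_trivIset pP.
have fP u : f u \in P /\ widen_ord le_mn u \in f u.
  by rewrite /f mem_pblock pblock_mem (cover_partition pP) inE.
suff -> : restrict le_mn P = preim_partition f [set: 'I_m]%SET.
  by rewrite pblock_kernel.
apply/setP => B; rewrite !inE; apply/andP/imsetP.
  move=> [/set0Pn[u uB] /imsetP[A AP BE]]; exists u; first by rewrite inE.
  have fu : f u = A by apply: def_pblock; move: uB; rewrite ?BE ?inE.
  apply/setP => v; rewrite BE !inE/= fu eq_sym.
  apply/idP/eqP => [vA|<-]; last exact: (fP v).2.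
  exact: def_pblock.
move=> [u _ ->]; split; first by apply/set0Pn; exists u; rewrite !inE/= eqxx.
apply/imsetP; exists (f u); first exact: (fP u).1.
apply/setP => v; rewrite !inE/=; apply/eqP/idP => [->|vu]; first exact: (fP v).2.
by rewrite -(def_pblock tP (fP u).1 vu).
Qed.

End restriction.

Section sampling.
Context (R : realType) (n N : nat) (le_nN : (n <= N)%N).
Implicit Types (P : {set {set 'I_n}}) (Q : {set {set 'I_N}}).

Definition permute_partition (s : 'S_N) Q : {set {set 'I_N}} :=
  [set [set s i | i in A] | A : {set 'I_N} in Q]%SET.

Lemma permute_partitionK s : cancel (permute_partition s) (permute_partition s^-1).
Proof.
move=> Q; rewrite /permute_partition -imset_comp -[RHS]imset_id.
apply: eq_imset => A /=; rewrite -imset_comp -[RHS]imset_id.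
by apply: eq_imset => i /=; rewrite permK.
Qed.

Lemma permute_partitionP s Q :
  partition (permute_partition s Q) [set: 'I_N]%SET = partition Q [set: 'I_N]%SET.
Proof.
have sT : s @: [set: 'I_N]%SET = [set: 'I_N]%SET.
  apply/setP => i; rewrite !inE; apply/imsetP.
  by exists (s^-1 i)%g; rewrite ?inE// permKV.
by rewrite -[in LHS]sT; apply: imset_partition; exact: perm_inj.
Qed.

Lemma pblock_permute s Q x : partition Q [set: 'I_N]%SET ->
  pblock (permute_partition s Q) (s x) = [set s i | i in pblock Q x]%SET.
Proof.
move=> pQ; have xQ : x \in cover Q by rewrite (cover_partition pQ) inE.
apply: def_pblock.
- by apply: (@partition_trivIset _ _ [set: 'I_N]%SET); rewrite permute_partitionP.
- exact/imset_f/pblock_mem.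
- by rewrite imset_f// mem_pblock.
Qed.

Lemma perm_extending (f : {ffun 'I_n -> 'I_N}) : injective f ->
  exists s : 'S_N, forall i, s (widen_ord le_nN i) = f i.
Proof.
(* r is a duplicate-free enumeration of 'I_N that begins with the values of f. *)
move=> finj; pose r := codom f ++ [seq x <- enum 'I_N | x \notin codom f].
have ur : uniq r.
  have uf : uniq (codom f) by exact/injectiveP.
  rewrite cat_uniq uf filter_uniq ?enum_uniq// andbT.
  by apply/hasPn => x; rewrite mem_filter => /andP[].
have sr : size r = N.
  rewrite -[RHS]card_ord cardE; apply/perm_size/uniq_perm; rewrite ?enum_uniq// => x.
  by rewrite mem_cat mem_filter mem_enum andbT inE orbN.
have r_inj : injective (fun x : 'I_N => tnth (Tuple (introT eqP sr)) x).
  by apply/tuple_uniqP.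
exists (perm r_inj) => i; rewrite permE (tnth_nth (f i))/= nth_cat size_codom card_ord.
by rewrite ltn_ord (nth_map i) ?size_enum_ord// nth_ord_enum.
Qed.

Lemma sum_ranked_block_size Q b : partition Q [set: 'I_N]%SET -> (0 < b)%N ->
  (\sum_(j < N) ranked_block_size Q j ^ b = \sum_(A in Q) #|A| ^ b)%N.
Proof.
move=> pQ b0; rewrite /ranked_block_size; set s := sort _ _.
have ss : perm_eq s [seq #|A| | A : {set 'I_N} <- enum Q].
  by rewrite perm_sort perm_map// perm_sort.
rewrite -[RHS](big_enum _ _ Q)/= -(big_map (fun A : {set 'I_N} => #|A|) predT (fun v => v ^ b)%N).
rewrite -(perm_big _ ss)/= (big_nth 0%N) -(big_mkord predT (fun j => nth 0 s j ^ b)%N).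
have sN : (size s <= N)%N.
  rewrite (perm_size ss) size_map -cardE -[leqRHS]card_ord -cardsT.
  rewrite (card_partition pQ) -sum1_card; apply: leq_sum => A AQ.
  by rewrite card_gt0 (partition_neq0 pQ).
rewrite (big_cat_nat (leq0n _) sN)/= [X in (_ + X)%N]big_nat.
rewrite [X in (_ + X)%N]big1 ?addn0// => j /andP[sj _].
by rewrite nth_default// exp0n.
Qed.

(** Group the samples by the blocks [j i] of [Q] that contain them: the samples
    with labels [j] number [\prod_i #|j i|], and [prod_power_sums] sums this
    over the labellings that are constant on the blocks of [P]. *)
Lemma card_samples P Q : partition P [set: 'I_n]%SET -> partition Q [set: 'I_N]%SET ->
  #|[set s : {ffun 'I_n -> 'I_N} | refines (fun i => pblock Q (s i)) P]%SET| =
  (\prod_(B in P) \sum_(j < N) ranked_block_size Q j ^ #|B|)%N.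
Proof.
move=> pP pQ; rewrite -sum1_card.
pose lab (s : {ffun 'I_n -> 'I_N}) : {ffun 'I_n -> {set 'I_N}} := [ffun i => pblock Q (s i)].
pose x (A : {set 'I_N}) := #|[set t | pblock Q t == A]%SET|.
have refl (s : {ffun 'I_n -> 'I_N}) : refines (fun i => pblock Q (s i)) P = refines (lab s) P.
  by apply: eq_forallb => u; apply: eq_forallb => v; rewrite !ffunE.
rewrite (partition_big lab (fun j => refines j P))/=; last first.
  by move=> s; rewrite inE refl.
transitivity (\sum_(j : {ffun 'I_n -> {set 'I_N}} | refines j P) \prod_i x (j i))%N.
  apply: eq_bigr => j rj; rewrite sum1_card.
  transitivity #|family (fun i => mem [set t | pblock Q t == j i]%SET)|.
    apply: eq_card => s; rewrite unfold_in/= inE refl; apply/andP/familyP.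
      by move=> [_ /eqP <- i]; rewrite inE ffunE.
    move=> sj; have -> : lab s = j; last by rewrite eqxx.
    by apply/ffunP => i; have := sj i; rewrite inE ffunE => /eqP.
  by rewrite card_family foldrE big_map big_enum; apply: eq_bigr.
have xE A : x A = if A \in Q then #|A| else 0%N.
  case: ifP => [AQ|AQ].
    apply: eq_card => t; rewrite inE; apply/eqP/idP => [<-|tA].
      by rewrite mem_pblock (cover_partition pQ) inE.
    by rewrite (def_pblock (partition_trivIset pQ) AQ tA).
  apply: eq_card0 => t; rewrite inE; apply: contraFF AQ => /eqP <-.
  by rewrite pblock_mem// (cover_partition pQ) inE.
apply/eqP; rewrite -(eqr_nat int) natr_sum; apply/eqP.
under eq_bigr do rewrite natr_prod.
rewrite (prod_power_sums (fun A => (x A)%:R) set0 pP) natr_prod.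
apply: eq_bigr => B BP; have B0 : (0 < #|B|)%N by rewrite card_gt0 (partition_neq0 pP).
rewrite sum_ranked_block_size// natr_sum [RHS]big_mkcond/=.
by apply: eq_bigr => A _; rewrite -natrX xE; case: ifP => //; rewrite exp0n.
Qed.

Variable a : {set {set 'I_N}} -> R.
Hypothesis a_ge0 : forall Q, 0 <= a Q.
Hypothesis a_sum1 : \sum_(Q | partition Q [set: 'I_N]%SET) a Q = 1.
Hypothesis a_exch : forall s Q, a (permute_partition s Q) = a Q.

Let respect_prob P (s : 'I_n -> 'I_N) := \sum_(Q | partition Q [set: 'I_N]%SET &&
    refines (fun i => pblock Q (s i)) P) a Q.

(** Exchangeability: a permutation that sends [i] to [s i] preserves the law. *)
Lemma respect_prob_injective P (s : {ffun 'I_n -> 'I_N}) :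
  partition P [set: 'I_n]%SET -> injective s ->
  respect_prob P s = respect_prob P (widen_ord le_nN).
Proof.
move=> pP /perm_extending[t ts]; rewrite /respect_prob.
rewrite (reindex_inj (can_inj (permute_partitionK t)))/=.
apply: eq_big => [Q|Q _]; last exact: a_exch.
rewrite permute_partitionP; case pQ : (partition Q _) => //=.
apply: eq_forallb => x; apply: eq_forallb => y; congr (_ ==> _).
rewrite -!ts !pblock_permute//.
apply/eqP/eqP => [|->//]; apply: imset_inj; exact: perm_inj.
Qed.

(** By [card_samples] the first sum is the average of [respect_prob P s] over
    all the samples [s].  The injective ones, in proportion
    [(N ^_ n) / N ^ n], all give [respect_prob P (widen_ord le_nN)], and the
    others give values between 0 and 1. *)
Theorem sampling_with_replacement P : (0 < N)%N -> partition P [set: 'I_n]%SET ->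
  `| \sum_(Q | partition Q [set: 'I_N]%SET) a Q *
       \prod_(B in P) \sum_(j < N) ((ranked_block_size Q j)%:R / N%:R) ^+ #|B|
     - respect_prob P (widen_ord le_nN) | <= 1 - (N ^_ n)%:R / N%:R ^+ n.
Proof.
move=> N0 pP; set G := respect_prob _ _.
have -> : \sum_(Q | partition Q [set: 'I_N]%SET) a Q *
       \prod_(B in P) \sum_(j < N) ((ranked_block_size Q j)%:R / N%:R) ^+ #|B| =
    (\sum_(s : {ffun 'I_n -> 'I_N}) respect_prob P s) / N%:R ^+ n.
  rewrite /respect_prob; under [in RHS]eq_bigr do rewrite big_mkcondr/=.
  rewrite exchange_big/= mulr_suml; apply: eq_bigr => Q pQ.
  rewrite -big_mkcond sumr_const -[a Q *+ _]mulr_natr -mulrA; congr (_ * _).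
  rewrite [X in _ = X%:R / _](etrans (esym (cardsE _)) (card_samples pP pQ)).
  rewrite natr_prod -[X in _ ^+ X]card_ord -cardsT (card_partition pP).
  rewrite -prodrXr -prodf_div; apply: eq_bigr => B BP.
  rewrite natr_sum mulr_suml; apply: eq_bigr => j _.
  by rewrite natrX expr_div_n.
have G_ge0 s : 0 <= respect_prob P s by apply: sumr_ge0.
have G_le1 s : respect_prob P s <= 1.
  by rewrite -a_sum1 /respect_prob [leLHS]big_mkcondr/=; apply: ler_sum => Q _; case: ifP.
rewrite (bigID (fun s : {ffun 'I_n -> 'I_N} => injectiveb s))/=.
rewrite (eq_bigr (fun=> G)) => [|s /injectiveP]; last exact: respect_prob_injective.
rewrite sumr_const.
set S := \sum_(i | _) _; pose M : R := N%:R ^+ n.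
have M0 : 0 < M by rewrite exprn_gt0// ltr0n.
have cardI : #|[pred s : {ffun 'I_n -> 'I_N} | injectiveb s]| = (N ^_ n)%N.
  by have := card_inj_ffuns 'I_n 'I_N; rewrite !card_ord cardsE.
have S0 : 0 <= S by apply: sumr_ge0.
have SM : S <= M - (N ^_ n)%:R.
  apply: (@le_trans _ _ (\sum_(s : {ffun 'I_n -> 'I_N} | ~~ injectiveb s) 1)).
    exact: ler_sum.
  rewrite sumr_const -cardI lerBrDr -natrD addnC.
  rewrite [X in X%:R](cardC [pred s : {ffun 'I_n -> 'I_N} | injectiveb s]).
  by rewrite card_ffun !card_ord natrX.
have -> : #|(fun i : {ffun 'I_n -> 'I_N} => injectiveb i)| = (N ^_ n)%N by rewrite -cardI.
rewrite -/M -[G *+ _]mulr_natr.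
have := G_ge0 (widen_ord le_nN); have := G_le1 (widen_ord le_nN); rewrite -/G.
move: ((N ^_ n)%:R : R) SM => f SM G1 G0.
have -> : (G * f + S) / M - G = (S - G * (M - f)) / M by field; rewrite gt_eqF.
have -> : 1 - f / M = (M - f) / M by field; rewrite gt_eqF.
rewrite normrM (gtr0_norm (_ : 0 < M^-1)) ?invr_gt0// ler_pM2r ?invr_gt0//.
rewrite ler_norml; apply/andP; split; nra.
Qed.

End sampling.

From mathcomp Require Import finmap.
From mathcomp Require Import all_classical all_reals all_analysis.
From mathcomp Require Import measurable_realfun.
Import numFieldNormedType.Exports.
Local Open Scope classical_set_scope.
Local Open Scope ring_scope.

(** * Limits of power sums *)

Section real_limits.
Context (R : realType).
Implicit Types (u v f : nat -> R).

Lemma cvg0_le u v : (forall k, `|u k| <= v k) -> v @ \oo --> (0 : R) ->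
  u @ \oo --> (0 : R).
Proof.
move=> uv v0; apply/norm_cvg0P.
by apply: (squeeze_cvgr _ (cvg_cst 0) v0); apply: nearW => k; rewrite normr_ge0 uv.
Qed.

Lemma cvg_sum_ord (I : finType) (P : pred I) (u : nat -> I -> R) (l : I -> R) :
  (forall i, P i -> u ^~ i @ \oo --> l i) ->
  (fun k => \sum_(i | P i) u k i) @ \oo --> \sum_(i | P i) l i.
Proof. by move=> ul; apply: cvg_big => //; exact: add_continuous. Qed.

(** Telescoping; this turns convergence of the factors into convergence of the
    products, and applied to equal factors gives [dist_exp_le]. *)
Lemma dist_prod_le (I : eqType) (s : seq I) (P : pred I) (a b : I -> R) :
  (forall i, 0 <= a i <= 1) -> (forall i, 0 <= b i <= 1) ->
  `|\prod_(i <- s | P i) a i - \prod_(i <- s | P i) b i| <=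
  \sum_(i <- s | P i) `|a i - b i|.
Proof.
move=> a01 b01; elim: s => [|i s IHs]; first by rewrite !big_nil subrr normr0.
rewrite !big_cons; case: (P i) => //.
have b'01 : 0 <= \prod_(j <- s | P j) b j <= 1.
  by apply/andP; split; [apply: prodr_ge0 => j _; case/andP: (b01 j)|
    apply: prodr_ile1].
move: IHs b'01; set A := \prod_(_ <- _ | _) a _; set B := \prod_(_ <- _ | _) b _.
move=> IHs /andP[B0 B1]; have /andP[a0 a1] := a01 i.
have -> : a i * A - b i * B = a i * (A - B) + (a i - b i) * B by ring.
apply: le_trans (ler_normD _ _) _; rewrite addrC; apply: lerD.
  by rewrite normrM (ger0_norm B0) ler_piMr.
by apply: le_trans IHs; rewrite normrM (ger0_norm a0) ler_piMl.
Qed.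

Lemma prod_diff_cvg0 (I : finType) (P : pred I) (u v : nat -> I -> R) :
  (forall k i, 0 <= u k i <= 1) -> (forall k i, 0 <= v k i <= 1) ->
  (forall i, P i -> (fun k => u k i - v k i) @ \oo --> (0 : R)) ->
  (fun k => \prod_(i | P i) u k i - \prod_(i | P i) v k i) @ \oo --> (0 : R).
Proof.
move=> u01 v01 uv.
apply: (@cvg0_le _ (fun k => \sum_(i | P i) `|u k i - v k i|)).
  by move=> k; exact: dist_prod_le.
rewrite [X in _ --> X](_ : _ = \sum_(i | P i) (0 : R)); last by rewrite big1.
by apply: cvg_sum_ord => i Pi; apply/norm_cvg0P; exact: uv.
Qed.

Lemma dist_exp_le b (x y : R) : 0 <= x <= 1 -> 0 <= y <= 1 ->
  `|x ^+ b - y ^+ b| <= b%:R * `|x - y|.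
Proof.
move=> x01 y01; have := @dist_prod_le _ (enum 'I_b) predT (fun=> x) (fun=> y).
rewrite !big_enum !prodr_const !sumr_const card_ord mulr_natl.
by apply.
Qed.

(** Pointwise convergence to a sequence of total mass one is convergence in
    [l^1]: beyond a [K] with [\sum_(k < K) f k > 1 - e], both [f] and the
    [y N] have little mass.  Powers are Lipschitz on the unit interval. *)
Lemma scheffe f (y : nat -> nat -> R) b :
  (forall k, 0 <= f k <= 1) -> (forall N k, 0 <= y N k <= 1) ->
  (forall N, \sum_(k < N) f k <= 1) -> (forall N, \sum_(k < N) y N k <= 1) ->
  (forall k, y ^~ k @ \oo --> f k) ->
  (fun N => \sum_(k < N) f k) @ \oo --> (1 : R) ->
  (fun N => \sum_(k < N) y N k ^+ b - \sum_(k < N) f k ^+ b) @ \oo --> (0 : R).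
Proof.
move=> f01 y01 f1 y1 yf sf.
suff L1 : (fun N => \sum_(k < N) `|y N k - f k|) @ \oo --> (0 : R).
  apply: (@cvg0_le _ (fun N => b%:R * \sum_(k < N) `|y N k - f k|)); last first.
    by rewrite -[X in _ --> X](mulr0 b%:R); apply: cvgM => //; exact: cvg_cst.
  move=> N; rewrite -sumrB mulr_sumr; apply: le_trans (ler_norm_sum _ _ _) _.
  by apply: ler_sum => k _; exact: dist_exp_le.
apply/cvgrPdist_lt => e e0.
have e4 : 0 < e / 4 by rewrite divr_gt0.
have /cvgrPdist_lt/(_ _ e4)[K _ /(_ K (leqnn _))/= fK] := sf.
have yK : (fun N => \sum_(k < K) `|y N k - f k|) @ \oo --> (0 : R).
  rewrite [X in _ --> X](_ : _ = \sum_(k < K) (0 : R)); last by rewrite big1.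
  apply: cvg_sum_ord => k _; apply/norm_cvg0P.
  by rewrite -(subrr (f k)); apply: cvgB => //; exact: cvg_cst.
move/cvgrPdist_lt/(_ _ e4): yK => [N1 _ HN1].
exists (maxn N1 K) => // N /=; rewrite geq_max => /andP[N1N KN].
have := HN1 _ N1N; rewrite /= !sub0r !normrN !ger0_norm ?sumr_ge0// => yN.
have split u : \sum_(k < N) u k = \sum_(k < K) u k + \sum_(K <= k < N) u k.
  by rewrite -!(big_mkord xpredT u) (big_cat_nat _ KN).
rewrite (split (fun k => `|y N k - f k|)); have tail : \sum_(K <= k < N) `|y N k - f k| <=
    \sum_(K <= k < N) y N k + \sum_(K <= k < N) f k.
  rewrite -big_split/=; apply: ler_sum => k _; apply: le_trans (ler_normB _ _) _.
  by have /andP[? _] := f01 k; have /andP[? _] := y01 N k; rewrite !ger0_norm.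
have := f1 N; have := y1 N; rewrite (split (y N)) (split f) => y1N f1N.
have fK' : \sum_(k < K) f k > 1 - e / 4.
  by move: fK; rewrite ger0_norm; [lra|have := f1 K; lra].
have yK' : \sum_(k < K) f k - \sum_(k < K) y N k <= \sum_(k < K) `|y N k - f k|.
  rewrite -sumrB; apply: ler_sum => k _; rewrite distrC; exact: ler_norm.
have : \sum_(K <= k < N) f k >= 0 by apply: sumr_ge0 => k _; case/andP: (f01 k).
lra.
Qed.

End real_limits.

Section weights.
Context (R : realType).
Implicit Types (p r x y : nat -> R).

Lemma nneseries_cvg_fin x (l : R) : (forall k, 0 <= x k) ->
  (\sum_(0 <= k <oo) (x k)%:E = l%:E)%E ->
  (fun K => \sum_(k < K) x k) @ \oo --> l.
Proof.
move=> x0 xl; have : (fun K => \sum_(0 <= k < K) (x k)%:E)%E @ \oo --> l%:E.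
  by rewrite -xl; apply: is_cvg_nneseries => k _ _; rewrite lee_fin.
move=> /fine_cvg; apply: cvg_trans; apply: near_eq_cvg; apply: nearW => K /=.
by rewrite sumEFin/= big_mkord.
Qed.

(** The sets [r = v] and [p = v] are in bijection for every [v > 0]; together
    these bijections match the supports of [r] and [p].  The terms off the
    support vanish as [g 0 = 0]. *)
Lemma sum_rearrangement r p (g : R -> R) : decreasing_rearrangement r p ->
  (forall k, 0 <= p k) -> g 0 = 0 ->
  (\sum_(0 <= k <oo) `|g (r k)|%:E = \sum_(0 <= k <oo) `|g (p k)|%:E)%E.
Proof.
move=> [_ r0 rp] p0 g0.
rewrite nneseries_esumT; last by move=> k; rewrite lee_fin.
rewrite nneseries_esumT; last by move=> k; rewrite lee_fin.
have supp x : (forall k, 0 <= x k) -> (\esum_(k in [set: nat]) `|g (x k)|%:E =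
    \esum_(k in [set k | (0 < x k)%R]) `|g (x k)|%:E)%E.
  move=> x0; rewrite [RHS]esum_mkcond; apply: eq_esum => k _.
  case: ifPn => // /negP; rewrite in_setE/= lt_neqAle x0 andbT => /negP.
  by rewrite negbK => /eqP <-; rewrite g0 normr0.
rewrite (supp r r0) (supp p p0).
have /choice[phi phiP] : forall v : R, exists f : nat -> nat,
    0 < v -> set_bij [set k | r k = v] [set k | p k = v] f.
  move=> v; have [v0|v0] := ltP 0 v; last by exists id.
  by have /card_set_bijP[f fP] := rp v v0; exists f.
pose e k := phi (r k) k.
have eE k : 0 < r k -> p (e k) = r k.
  by move=> /phiP[+ _ _] => /(_ k)/(_ erefl).
rewrite [RHS](@reindex_esum _ _ _ [set k | 0 < r k] _ e).
  by apply: eq_esum => k /= k0; rewrite eE.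
split=> [k /= k0|j k /set_mem/= j0 /set_mem/= k0 jk|k /= k0].
- by rewrite eE.
- have rjk : r j = r k by rewrite -(eE j) // jk eE.
  move: jk; rewrite /e rjk; have [_ + _] := phiP _ k0; apply; rewrite inE//.
- have [_ _ /(_ k erefl)[j /= rj <-]] := phiP _ k0.
  by exists j; rewrite /= /e rj.
Qed.

Definition proper_weights x := (forall k, 0 <= x k <= 1) /\
  (fun K => \sum_(k < K) x k) @ \oo --> (1 : R).

Lemma proper_weights_sum_le1 x K : proper_weights x -> \sum_(k < K) x k <= 1.
Proof.
move=> [x01 x1]; rewrite -(cvg_lim (@Rhausdorff R) x1).
apply: (nondecreasing_cvgn_le (u_ := fun K => \sum_(k < K) x k)); last first.
  by apply/cvg_ex; exists 1.
move=> m n mn; rewrite -!(big_mkord xpredT x) (big_cat_nat (leq0n m) mn)/= lerDl.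
by apply: sumr_ge0 => k _; case/andP: (x01 k).
Qed.

Lemma proper_weightsP x : (forall k, 0 <= x k) ->
  (\sum_(0 <= k <oo) (x k)%:E = 1)%E -> proper_weights x.
Proof.
move=> x0 x1; split; last exact: nneseries_cvg_fin.
move=> k; rewrite x0/= -lee_fin -x1.
apply: le_trans (nneseries_lim_ge k.+1 _) => [|j _]; last by rewrite lee_fin.
rewrite big_nat_recr//= leeDr// sume_ge0// => j _; by rewrite lee_fin.
Qed.

Lemma power_sum_le p K b : (0 < b)%N -> (forall k, 0 <= p k <= 1) ->
  \sum_(k < K) p k ^+ b <= \sum_(k < K) p k.
Proof.
move=> b0 p01; apply: ler_sum => k _; case: b b0 => // b _; rewrite exprS.
by have /andP[p0 p1] := p01 k; rewrite ler_piMr// exprn_ile1.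
Qed.

Lemma rearrangement_proper r p : decreasing_rearrangement r p ->
  proper_weights p -> proper_weights r.
Proof.
move=> rp [p01 p1]; have p0 k : 0 <= p k by case/andP: (p01 k).
have r0 : forall k, 0 <= r k by case: rp.
apply: proper_weightsP => //.
have := sum_rearrangement (g := id) rp p0 erefl.
under eq_eseriesr do rewrite ger0_norm//.
under [in RHS]eq_eseriesr do rewrite ger0_norm//.
move=> ->; apply/cvg_lim => //.
rewrite (_ : (fun n => _) = EFin \o (fun K => \sum_(k < K) p k)).
  by apply: cvg_EFin => //; exact: nearW.
by apply/funext => K /=; rewrite sumEFin big_mkord.
Qed.

Lemma rearrangement_power_sums r p b : (0 < b)%N -> decreasing_rearrangement r p ->
  proper_weights p ->
  (fun K => \sum_(k < K) p k ^+ b - \sum_(k < K) r k ^+ b) @ \oo --> (0 : R).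
Proof.
move=> b0 rp pp; have rr := rearrangement_proper rp pp.
have p0 k : 0 <= p k by case/andP: (pp.1 k).
have r0 k : 0 <= r k by case/andP: (rr.1 k).
have := sum_rearrangement (g := fun v => v ^+ b) rp p0.
rewrite expr0n eqn0Ngt b0 => /(_ erefl).
under eq_eseriesr do rewrite ger0_norm ?exprn_ge0//.
under [in RHS]eq_eseriesr do rewrite ger0_norm ?exprn_ge0//.
set L := (\sum_(0 <= k <oo) (p k ^+ b)%:E)%E => rL.
have L1 : (0 <= L <= 1)%E.
  apply/andP; split; first by apply: nneseries_ge0 => k _ _; rewrite lee_fin exprn_ge0.
  apply: lime_le; first by apply: is_cvg_nneseries => k _ _; rewrite lee_fin exprn_ge0.
  apply: nearW => K; rewrite sumEFin lee_fin big_mkord.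
  by apply: le_trans (power_sum_le _ b0 pp.1) (proper_weights_sum_le1 _ pp).
have Lfin : L \is a fin_num.
  by case/andP: L1 => L0 L1; rewrite ge0_fin_numE// (le_lt_trans L1) ?ltry.
have LE : L = (fine L)%:E by rewrite fineK.
have cp : (fun K => \sum_(k < K) p k ^+ b) @ \oo --> fine L.
  by apply: (@nneseries_cvg_fin (fun k => p k ^+ b)) => [k|]; rewrite ?exprn_ge0.
have cr : (fun K => \sum_(k < K) r k ^+ b) @ \oo --> fine L.
  by apply: (@nneseries_cvg_fin (fun k => r k ^+ b)) => [k|]; rewrite ?exprn_ge0// rL.
have cpr := cvgB cp cr; rewrite subrr in cpr; exact: cpr.
Qed.

End weights.

(** * Expectations of bounded random variables *)

Section expectations.
Context d (Omega : measurableType d) (R : realType) (P : probability Omega R).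
Implicit Types (X Y : Omega -> R).

Lemma integrable_bounded X M : measurable_fun setT X -> (forall w, `|X w| <= M) ->
  P.-integrable setT (EFin \o X).
Proof.
move=> mX XM; apply: measurable_bounded_integrable => //.
  by rewrite (le_lt_trans (probability_le1 P measurableT)) ?ltry.
exists M; split=> [|x Mx w _]; first exact: num_real.
exact: le_trans (XM w) (ltW Mx).
Qed.

Lemma Rintegral_sum (I : Type) (s : seq I) (Q : pred I) (X : I -> Omega -> R) :
  (forall i, Q i -> P.-integrable setT (EFin \o X i)) ->
  \int[P]_w (\sum_(i <- s | Q i) X i w) = \sum_(i <- s | Q i) \int[P]_w X i w.
Proof.
move=> iX; elim: s => [|i s IHs].
  by under eq_Rintegral do rewrite big_nil; rewrite Rintegral_cst// mul0r big_nil.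
under eq_Rintegral do rewrite big_cons; rewrite big_cons.
case: ifPn => // Qi; rewrite RintegralD ?IHs//; first exact: iX.
rewrite (_ : _ \o _ = fun w => (\sum_(j <- s | Q j) (X j w)%:E)%E).
  exact: integrable_sum.
by apply/funext => w /=; rewrite -sumEFin.
Qed.

Lemma Rintegral_ae_eq X Y : measurable_fun setT X -> measurable_fun setT Y ->
  {ae P, forall w, X w = Y w} -> \int[P]_w X w = \int[P]_w Y w.
Proof.
move=> mX mY XY; congr fine; apply: ae_eq_integral => //.
- exact/measurable_EFinP.
- exact/measurable_EFinP.
- by apply: filterS XY => w -> _.
Qed.

(** Dominated convergence in the form used below: comparing two sequences of
    random variables requires no measurable limit for either of them. *)
Lemma Rintegral_diff_cvg0 (X Y : nat -> Omega -> R) (M : R) :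
  (forall K, measurable_fun setT (X K)) -> (forall K, measurable_fun setT (Y K)) ->
  (forall K w, `|X K w| <= M) -> (forall K w, `|Y K w| <= M) ->
  {ae P, forall w, (fun K => X K w - Y K w) @ \oo --> (0 : R)} ->
  (fun K => \int[P]_w X K w - \int[P]_w Y K w) @ \oo --> (0 : R).
Proof.
move=> mX mY bX bY XY.
have [] := @dominated_convergence _ _ _ P setT measurableT
   (fun K w => (X K w - Y K w)%:E) (cst 0%E) (cst (M + M)%:E).
- by move=> K; apply/measurable_EFinP; exact: measurable_funB.
- exact: measurable_cst.
- by apply: filterS XY => w XYw _; apply: cvg_EFin => //; exact: nearW.
- exact: finite_measure_integrable_cst.
- apply: aeW => w K _; rewrite lee_fin; apply: le_trans (ler_normB _ _) _.
  exact: lerD.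
move=> _ _; rewrite integral0 => /fine_cvgP[_]; apply: cvg_trans.
apply: near_eq_cvg; apply: nearW => K /=.
by rewrite -RintegralB//; apply: integrable_bounded.
Qed.

Lemma Rintegral_one : \int[P]_w (1 : R) = 1.
Proof. rewrite Rintegral_cst// mul1r; exact: (congr1 fine (probability_setT P)). Qed.

End expectations.

Lemma eq_law_Rintegral (R : realType) d1 d2 d (Omega1 : measurableType d1)
    (Omega2 : measurableType d2) (T : measurableType d)
    (P1 : probability Omega1 R) (P2 : probability Omega2 R)
    (X1 : Omega1 -> T) (X2 : Omega2 -> T) (g : T -> R) :
  measurable_fun setT X1 -> measurable_fun setT X2 -> eq_law P1 P2 X1 X2 ->
  measurable_fun setT g -> (forall x, 0 <= g x) ->
  \int[P1]_w g (X1 w) = \int[P2]_w g (X2 w).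
Proof.
move=> mX1 mX2 e12 mg g0; congr fine.
pose Y1 : {mfun Omega1 >-> T} := mfun_Sub (mem_set mX1).
pose Y2 : {mfun Omega2 >-> T} := mfun_Sub (mem_set mX2).
have mg' : measurable_fun setT (EFin \o g) by exact/measurable_EFinP.
transitivity (\int[distribution P1 Y1]_x (g x)%:E)%E.
  by rewrite ge0_integral_distribution// => x; rewrite lee_fin.
transitivity (\int[distribution P2 Y2]_x (g x)%:E)%E; last first.
  by rewrite ge0_integral_distribution// => x; rewrite lee_fin.
by apply: eq_measure_integral => A mA _; exact: e12.
Qed.

Local Notation sequences T := (g_sigma_algebraType (@cylinders _ T)).

Section trajectories.
Context d d' (Omega : measurableType d) (T : measurableType d').

Lemma measurable_coordinate i : measurable_fun setT (fun s : sequences T => s i).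
Proof.
move=> _ A mA; apply: sub_sigma_algebra; exists i => //.
by exists A.
Qed.

Lemma measurable_trajectory (X : nat -> Omega -> T) :
  (forall i, measurable_fun setT (X i)) -> measurable_fun setT (trajectory X).
Proof.
move=> mX; apply: (measurability (@cylinders _ T : set (set (sequences T)))) => //.
move=> _ [_ [i _ [A mA <-]] <-]; rewrite !setTI.
by have := mX i measurableT A mA; rewrite setTI.
Qed.

End trajectories.

Section finite_valued.
Context d (Omega : measurableType d) (R : realType) (P : probability Omega R).
Context (I : finType) (F : Omega -> I).
Hypothesis mF : forall i, measurable [set w | F w = i].

Lemma finite_valuedE (g : I -> R) w :
  g (F w) = \sum_i g i * \1_([set w | F w = i]) w.
Proof.
rewrite (bigD1 (F w))//= indicE mem_set// mulr1 big1 ?addr0// => i iF.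
by rewrite indicE memNset ?mulr0// => /= E; rewrite E eqxx in iF.
Qed.

Lemma measurable_finite_valued (g : I -> R) : measurable_fun setT (g \o F).
Proof.
rewrite (_ : _ \o _ = fun w => \sum_i g i * \1_([set w | F w = i]) w); last first.
  by apply/funext => w; exact: finite_valuedE.
apply: measurable_sum => i; apply: measurable_funM; first exact: measurable_cst.
exact: measurable_indic.
Qed.

Lemma Rintegral_finite_valued (g : I -> R) :
  \int[P]_w g (F w) = \sum_i g i * fine (P [set w | F w = i]).
Proof.
under eq_Rintegral do rewrite finite_valuedE.
have iI i : P.-integrable setT (EFin \o (\1_([set w | F w = i]) : Omega -> R)).
  apply: (@integrable_bounded _ _ _ _ _ 1); first exact: measurable_indic.
  by move=> w; rewrite indicE; case: (_ \in _); rewrite ?normr0 ?normr1.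
rewrite Rintegral_sum => [|i _]; last first.
  have := integrableZl measurableT (g i) (iI i).
  by apply: eq_integrable.
apply: eq_bigr => i _; rewrite RintegralZl//; congr (_ * _).
by rewrite /Rintegral integral_indic// setIT.
Qed.

End finite_valued.

(** * The EPPF in terms of the ranked frequencies *)

Section truncation.
Context (R : realType) (n : nat) (rho : {set {set 'I_n}}).
Hypothesis rho_part : finset.partition rho [set: 'I_n]%SET.

(** Weights and frequencies are only almost surely in the unit interval with
    sums at most one.  Truncating the entries and the sums keeps the integrands
    measurable, between 0 and 1 everywhere, and almost surely unchanged. *)
Definition clamp (x : R) : R := Num.max 0 (Num.min 1 x).

Definition power_factor K (s : nat -> R) (B : {set 'I_n}) : R :=
  Num.min 1 (\sum_(k < K) clamp (s k) ^+ #|B|).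

Definition power_product K (s : nat -> R) : R :=
  \prod_(B in rho) power_factor K s B.

Lemma clamp01 x : 0 <= clamp x <= 1.
Proof. by rewrite /clamp le_max lexx ge_max ler01 ge_min lexx. Qed.

Lemma clampE x : 0 <= x <= 1 -> clamp x = x.
Proof. by move=> /andP[x0 x1]; rewrite /clamp (min_idPr _)// (max_idPr _). Qed.

Lemma power_factor01 K s B : 0 <= power_factor K s B <= 1.
Proof.
rewrite /power_factor le_min ler01 ge_min lexx/= andbT.
by apply: sumr_ge0 => k _; rewrite exprn_ge0//; case/andP: (clamp01 (s k)).
Qed.

Lemma power_product01 K s : 0 <= power_product K s <= 1.
Proof.
apply/andP; split.
  by apply: prodr_ge0 => B _; case/andP: (power_factor01 K s B).
by apply: prodr_ile1 => B _; exact: power_factor01.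
Qed.

Lemma power_factorE K (s : nat -> R) B : B \in rho -> (forall k, 0 <= s k <= 1) ->
  \sum_(k < K) s k <= 1 -> power_factor K s B = \sum_(k < K) s k ^+ #|B|.
Proof.
move=> Br s01 s1; have B0 : (0 < #|B|)%N by rewrite card_gt0 (partition_neq0 rho_part).
rewrite /power_factor; under eq_bigr do rewrite clampE//.
by apply/min_idPr/(le_trans _ s1)/power_sum_le.
Qed.

Lemma power_productE K (s : nat -> R) : (forall k, 0 <= s k <= 1) ->
  \sum_(k < K) s k <= 1 ->
  power_product K s = \prod_(B in rho) \sum_(k < K) s k ^+ #|B|.
Proof. by move=> s01 s1; apply: eq_bigr => B Br; exact: power_factorE. Qed.

Lemma power_product_diff_cvg0 (s t : nat -> nat -> R) :
  (forall N k, 0 <= s N k <= 1) -> (forall N k, 0 <= t N k <= 1) ->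
  (forall N, \sum_(k < N) s N k <= 1) -> (forall N, \sum_(k < N) t N k <= 1) ->
  (forall b, (0 < b)%N ->
    (fun N => \sum_(k < N) s N k ^+ b - \sum_(k < N) t N k ^+ b) @ \oo --> (0 : R)) ->
  (fun N => power_product N (s N) - power_product N (t N)) @ \oo --> (0 : R).
Proof.
move=> s01 t01 s1 t1 st.
apply: (@prod_diff_cvg0 _ _ _ (fun N => power_factor N (s N)) (fun N => power_factor N (t N))).
- by move=> N B; exact: power_factor01.
- by move=> N B; exact: power_factor01.
move=> B Br; have B0 : (0 < #|B|)%N by rewrite card_gt0 (partition_neq0 rho_part).
apply: cvg_trans (st _ B0); apply: near_eq_cvg; apply: nearW => N.
by rewrite /= !power_factorE.
Qed.

Lemma measurable_power_product d (Omega : measurableType d) K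
    (X : nat -> Omega -> R) : (forall k, measurable_fun setT (X k)) ->
  measurable_fun setT (fun w => power_product K (X ^~ w)).
Proof.
move=> mX; rewrite /power_product.
under eq_fun do rewrite -big_enum.
apply: measurable_prod => B _.
apply: measurable_minr; first exact: measurable_cst.
apply: measurable_sum => k; apply: measurable_funX.
apply: measurable_maxr; first exact: measurable_cst.
by apply: measurable_minr => //; exact: measurable_cst.
Qed.

End truncation.

Lemma ffact_ratio_cvg (R : realType) n :
  (fun N : nat => 1 - (N ^_ n)%:R / N%:R ^+ n : R) @ \oo --> (0 : R).
Proof.
have E : \forall N \near \oo, \prod_(i < n) (1 - i%:R / N%:R : R) =
    (N ^_ n)%:R / N%:R ^+ n.
  near=> N; have nN : (n < N)%N by near: N; exists n.+1.
  rewrite ffact_prod natr_prod -[n in _ ^+ n]card_ord -prodr_const -prodf_div.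
  apply: eq_bigr => i _; rewrite natrB ?mulrBl ?divff//.
    by rewrite pnatr_eq0 -lt0n (leq_ltn_trans _ nN).
  by rewrite ltnW// (ltn_trans _ nN).
have c1 : (fun N : nat => \prod_(i < n) (1 - i%:R / N%:R : R)) @ \oo --> \prod_(i < n) (1 : R).
  apply: cvg_big => //; first exact: mul_continuous.
  move=> i _; rewrite -[X in _ --> X]subr0; apply: cvgB; first exact: cvg_cst.
  rewrite -[X in _ --> X](mulr0 i%:R); apply: cvgM; first exact: cvg_cst.
  apply/(@gtr0_cvgV0 R nat \oo _ (fun N : nat => N%:R)); last exact: cvgr_idn.
  by near=> N; rewrite ltr0n; near: N; exists 1%N.
rewrite big1// in c1.
have c2 : (fun N : nat => (N ^_ n)%:R / N%:R ^+ n : R) @ \oo --> (1 : R).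
  by apply: cvg_trans c1; exact: near_eq_cvg.
have c3 := cvgB (cvg_cst (1 : R)) c2; rewrite subrr in c3; exact: c3.
Unshelve. all: by end_near. Qed.

Lemma cvg_le_near (R : realType) (u : nat -> R) l M : u @ \oo --> l ->
  (\forall N \near \oo, u N <= M) -> l <= M.
Proof.
move=> ul uM; rewrite -(cvg_lim (@Rhausdorff R) ul); apply: limr_le => //.
by apply/cvg_ex; exists l.
Qed.

Lemma cvg_ge_near (R : realType) (u : nat -> R) l M : u @ \oo --> l ->
  (\forall N \near \oo, M <= u N) -> M <= l.
Proof.
move=> ul uM; rewrite -(cvg_lim (@Rhausdorff R) ul); apply: limr_ge => //.
by apply/cvg_ex; exists l.
Qed.

Section full_mass.
Context (R : realType).

(** Total mass one, for nonnegative sequences with sums at most one, as a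
    measurable set of sequences: this is how the property passes from the
    ranked weights to the limiting frequencies, which have the same law. *)
Definition full_mass : set (nat -> R) :=
  \bigcap_m \bigcup_K [set s : nat -> R | 1 - m.+1%:R^-1 < \sum_(k < K) s k].

Lemma measurable_full_mass : measurable (full_mass : set (sequences R)).
Proof.
apply: bigcapT_measurable => m; apply: bigcupT_measurable => K.
have mS : measurable_fun setT (fun s : sequences R => \sum_(k < K) s k).
  by apply: measurable_sum => k; exact: measurable_coordinate.
have := mS measurableT `]1 - m.+1%:R^-1, +oo[%classic (measurable_itv _).
rewrite setTI; congr measurable; apply/seteqP; split=> s /=; by rewrite in_itv/= andbT.
Qed.

Lemma proper_full_mass (x : nat -> R) : proper_weights x -> full_mass x.
Proof.
move=> [_ x1] m _.
have e0 : 0 < m.+1%:R^-1 :> R by rewrite invr_gt0.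
have /cvgrPdist_lt/(_ _ e0)[K _ /(_ K (leqnn _))/= xK] := x1.
by exists K => //=; move: xK => /(le_lt_trans (ler_norm _)); rewrite ltrBlDr addrC -ltrBlDr.
Qed.

Lemma full_mass_proper (x : nat -> R) : (forall k, 0 <= x k <= 1) ->
  (forall K, \sum_(k < K) x k <= 1) -> full_mass x -> proper_weights x.
Proof.
move=> x01 x1 fx; split=> //; apply/cvgrPdist_lt => e e0.
have [m me] : exists m : nat, m.+1%:R^-1 < e.
  have /cvgrPdist_lt/(_ _ e0)[m _ /(_ m (leqnn _))/=] := @cvg_harmonic R.
  by rewrite sub0r normrN ger0_norm ?invr_ge0//; exists m.
have [K _ /= xK] := fx m I; exists K => // N /= KN.
have : \sum_(k < K) x k <= \sum_(k < N) x k.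
  rewrite -!(big_mkord xpredT x) (big_cat_nat (leq0n K) KN)/= lerDl.
  by apply: sumr_ge0 => k _; case/andP: (x01 k).
move=> KS; rewrite ger0_norm ?subr_ge0 ?x1// ltrBlDr.
by apply: lt_le_trans (lerD (ltW me) KS); rewrite -ltrBlDl.
Qed.

End full_mass.

Section kingman.
Context (R : realType) (q : seq nat -> R).
Context d' (Omega' : measurableType d') (P' : probability Omega' R).
Context (Pi : forall n, Omega' -> {set {set 'I_n}}) (f : nat -> {RV P' >-> R}).
Hypotheses (rP : random_partition Pi) (exP : exchangeable P' Pi)
  (eppf : has_eppf P' Pi q).

Let relative_size N k w : R := (ranked_block_size (Pi N w) k)%:R / N%:R.

Hypothesis fP : {ae P', forall w, forall k, relative_size ^~ k ^~ w @ \oo --> f k w}.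

Let part N w : finset.partition (Pi N w) [set: 'I_N]%SET.
Proof. by have [+ _ _] := rP; exact. Qed.

Let mPi N Q : measurable [set w | Pi N w = Q].
Proof. by have [_ + _] := rP; exact. Qed.

Lemma relative_size01 N k w : 0 <= relative_size N k w <= 1.
Proof.
rewrite /relative_size divr_ge0//=; have [->|N0] := posnP N; first by rewrite mulr0n invr0 mulr0.
rewrite ler_pdivrMr ?ltr0n// mul1r ler_nat /ranked_block_size.
set s := sort _ _; have : all (fun m => m <= N)%N s.
  by rewrite all_sort; apply/allP => _ /mapP[A _ ->]; rewrite -[leqRHS]card_ord max_card.
by move=> /all_nthP sN; have [/sN//|ks] := ltnP k (size s); rewrite nth_default.
Qed.

Lemma sum_relative_size_le1 N w : \sum_(k < N) relative_size N k w <= 1.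
Proof.
have [->|N0] := posnP N; first by rewrite big_ord0.
rewrite -mulr_suml -natr_sum ler_pdivrMr ?ltr0n// mul1r ler_nat.
have := sum_ranked_block_size (part N w) (ltn0Sn 0).
under eq_bigr do rewrite expn1; move=> ->.
rewrite -(card_partition (part N w)).
by rewrite -[leqRHS]card_ord max_card.
Qed.

(** Finite sums of relative block sizes are at most one, and so are their
    limits. *)
Lemma frequencies_subproper : {ae P', forall w, (forall k, 0 <= f k w <= 1) /\
  forall K, \sum_(k < K) f k w <= 1}.
Proof.
apply: filterS fP => w fw; split=> [k|K].
  apply/andP; split.
    by apply: (cvg_ge_near (fw k)); apply: nearW => N; case/andP: (relative_size01 N k w).
  by apply: (cvg_le_near (fw k)); apply: nearW => N; case/andP: (relative_size01 N k w).
have c : (fun N => \sum_(k < K) relative_size N k w) @ \oo --> \sum_(k < K) f k w.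
  by apply: cvg_sum_ord => k _; exact: fw.
apply: (cvg_le_near c); exists K => // N /= KN; apply: le_trans (sum_relative_size_le1 N w).
rewrite -!(big_mkord xpredT (relative_size N ^~ w)) (big_cat_nat (leq0n K) KN)/= lerDl.
by apply: sumr_ge0 => k _; case/andP: (relative_size01 N k w).
Qed.

Section upper_event.
Context (n : nat) (rho : {set {set 'I_n}}).
Hypothesis rho_part : finset.partition rho [set: 'I_n]%SET.

Definition coarser_prob : R :=
  \int[P']_w (refines (finset.pblock (Pi n w)) rho)%:R.

(** The event is a union of events [Pi n = Q], whose probabilities are values
    of the EPPF. *)
Lemma coarser_prob_sum : (0 < n)%N -> coarser_prob =
  \sum_(Q | finset.partition Q [set: 'I_n]%SET && refines (finset.pblock Q) rho) q (block_sizes Q).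
Proof.
move=> n0; have mPn Q := @mPi n Q.
rewrite /coarser_prob.
rewrite (Rintegral_finite_valued P' mPn (fun Q => (refines (finset.pblock Q) rho)%:R)).
rewrite [RHS]big_mkcond/=; apply: eq_bigr => Q _.
have [pQ|pQ] := boolP (finset.partition Q [set: 'I_n]%SET).
  have [_ /(_ n Q n0 pQ) ->] := eppf.
  by case: (refines _ _); rewrite /= ?mul1r ?mul0r.
rewrite [X in P' X](_ : _ = set0) ?measure0 ?mulr0//.
by apply/seteqP; split=> // w /= wQ; move: pQ; rewrite -wQ part.
Qed.

(** [Pi n] is the restriction of [Pi N], so that [0, .., n-1] is an injective
    sample from [{0, .., N-1}]. *)
Lemma sampled_coarser N : (n <= N)%N -> (0 < N)%N ->
  `| \int[P']_w power_product rho N (relative_size N ^~ w) - coarser_prob | <=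
  1 - (N ^_ n)%:R / N%:R ^+ n.
Proof.
move=> nN N0; pose a Q := fine (P' [set w | Pi N w = Q]).
have mPN Q := @mPi N Q.
have a0 Q : ~~ finset.partition Q [set: 'I_N]%SET -> a Q = 0.
  move=> pQ; rewrite /a [X in P' X](_ : _ = set0) ?measure0//.
  by apply/seteqP; split=> // w /= wQ; move: pQ; rewrite -wQ part.
have partsum g : \int[P']_w g (Pi N w) = \sum_(Q | finset.partition Q [set: 'I_N]%SET) a Q * g Q.
  rewrite (Rintegral_finite_valued P' mPN) [RHS]big_mkcond/=; apply: eq_bigr => Q _.
  by rewrite mulrC; case: ifPn => // /a0; rewrite /a => ->; rewrite mul0r.
have a_ge0 Q : 0 <= a Q by exact: fine_ge0.
have a_sum1 : \sum_(Q | finset.partition Q [set: 'I_N]%SET) a Q = 1.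
  have := partsum (fun=> 1); rewrite Rintegral_one => ->.
  by apply: eq_bigr => Q _; rewrite mulr1.
have a_exch s Q : a (permute_partition s Q) = a Q.
  rewrite /a -(exP s (permute_partition s Q)); congr (fine (P' _)).
  apply/seteqP; split=> w /= => [|->//].
  by move/(can_inj (permute_partitionK s)).
have -> : \int[P']_w power_product rho N (relative_size N ^~ w) =
    \sum_(Q | finset.partition Q [set: 'I_N]%SET) a Q *
      \prod_(B in rho) \sum_(j < N) ((ranked_block_size Q j)%:R / N%:R) ^+ #|B|.
  rewrite -partsum; apply: eq_Rintegral => w _; apply: power_productE => // [k|].
    exact: relative_size01.
  exact: sum_relative_size_le1.
have -> : coarser_prob = \sum_(Q | finset.partition Q [set: 'I_N]%SET &&
    refines (fun i => finset.pblock Q (widen_ord nN i)) rho) a Q.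
  transitivity (\int[P']_w (refines (fun i => finset.pblock (Pi N w) (widen_ord nN i)) rho)%:R : R).
    apply: eq_Rintegral => w _; have [_ _ /(_ n N nN w) <-] := rP.
    congr (nat_of_bool _)%:R; apply: eq_forallb => x; apply: eq_forallb => y.
    by rewrite pblock_restrict.
  rewrite (partsum (fun Q => (refines (fun i => finset.pblock Q (widen_ord nN i)) rho)%:R)).
  rewrite [RHS]big_mkcondr/=; apply: eq_bigr => Q _.
  by case: (refines _ _); rewrite /= ?mulr1 ?mulr0.
exact: sampling_with_replacement.
Qed.

End upper_event.

Context d0 (Omega0 : measurableType d0) (P0 : probability Omega0 R).
Context (p r : nat -> {RV P0 >-> R}).
Hypothesis p01 : forall k w, 0 <= p k w <= 1.
Hypothesis p_proper : {ae P0, forall w, proper_weights (p ^~ w)}.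
Hypothesis rp : {ae P0, forall w, decreasing_rearrangement (r ^~ w) (p ^~ w)}.
Hypothesis fr : eq_law P' P0 (trajectory f) (trajectory r).

Lemma frequencies_proper : {ae P', forall w, proper_weights (f ^~ w)}.
Proof.
have mf : measurable_fun setT (trajectory f) by apply: measurable_trajectory => k.
have mr : measurable_fun setT (trajectory r) by apply: measurable_trajectory => k.
have mA := @measurable_full_mass R.
have mB d1 (O : measurableType d1) (X : O -> sequences R) :
    measurable_fun setT X -> measurable (X @^-1` (~` (@full_mass R))).
  by move=> mX; rewrite -[X in measurable X]setTI; apply: mX => //; exact: measurableC.
have r0 : P0 (trajectory r @^-1` (~` (@full_mass R))) = 0%E.
  apply/(negligibleP _ (mB _ _ _ mr)); have : {ae P0, forall w, full_mass (r ^~ w)}.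
    move: rp p_proper; apply: filterS2 => w rpw pw.
    exact/proper_full_mass/(rearrangement_proper rpw pw).
  by [].
have : {ae P', forall w, full_mass (f ^~ w)}.
  exists (trajectory f @^-1` (~` (@full_mass R))); split => //; first exact: mB.
  by rewrite fr//; exact: measurableC.
move: frequencies_subproper; apply: filterS2 => w [f01 f1] fw.
exact: full_mass_proper.
Qed.

(** The chain of comparisons is: weights and ranked weights have the same power
    sums; ranked weights and frequencies have the same law; frequencies are
    close to relative block sizes; and sampling with replacement from the
    blocks of [Pi K] is close to sampling without replacement. *)
Lemma power_product_limit n (rho : {set {set 'I_n}}) : (0 < n)%N ->
  finset.partition rho [set: 'I_n]%SET ->
  (fun K => \int[P0]_w power_product rho K (p ^~ w)) @ \oo -->
  \sum_(Q | finset.partition Q [set: 'I_n]%SET && refines (finset.pblock Q) rho) q (block_sizes Q).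
Proof.
move=> n0 rho_part; rewrite -(@coarser_prob_sum n rho n0).
pose Ep K := \int[P0]_w power_product rho K (p ^~ w).
pose Er K := \int[P0]_w power_product rho K (r ^~ w).
pose Ef K := \int[P']_w power_product rho K (f ^~ w).
pose Ey K := \int[P']_w power_product rho K (relative_size K ^~ w).
have bound K s : `|power_product rho K s : R| <= 1.
  by have /andP[? ?] := power_product01 rho K s; rewrite ger0_norm.
have pr : (fun K => Ep K - Er K) @ \oo --> (0 : R).
  apply: (@Rintegral_diff_cvg0 _ _ _ P0 _ _ 1) => [K|K|K w|K w|]; rewrite ?bound//.
  - by apply: measurable_power_product.
  - by apply: measurable_power_product.
  move: rp p_proper; apply: filterS2 => w rpw pw.
  have rw := rearrangement_proper rpw pw.
  apply: (@power_product_diff_cvg0 _ _ _ rho_part (fun=> p ^~ w) (fun=> r ^~ w)).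
  - by move=> _; case: pw.
  - by move=> _; case: rw.
  - by move=> N; exact: (proper_weights_sum_le1 N pw).
  - by move=> N; exact: (proper_weights_sum_le1 N rw).
  - by move=> b b0; exact: (rearrangement_power_sums b0 rpw pw).
have rf K : Er K = Ef K.
  have mf : measurable_fun setT (trajectory f) by apply: measurable_trajectory => k.
  have mr : measurable_fun setT (trajectory r) by apply: measurable_trajectory => k.
  have mg : measurable_fun setT (fun s : sequences R => power_product rho K s).
    by apply: measurable_power_product => k; exact: measurable_coordinate.
  have g0 (s : sequences R) : 0 <= power_product rho K s.
    by case/andP: (power_product01 rho K s).
  by have /esym := eq_law_Rintegral mf mr fr mg g0.
have fy : (fun K => Ey K - Ef K) @ \oo --> (0 : R).
  apply: (@Rintegral_diff_cvg0 _ _ _ P' _ _ 1) => [K|K|K w|K w|]; rewrite ?bound//.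
  - apply: measurable_power_product => k.
    have mK Q := @mPi K Q.
    exact: (measurable_finite_valued mK (fun Q => (ranked_block_size Q k)%:R / K%:R)).
  - by apply: measurable_power_product.
  move: fP frequencies_proper; apply: filterS2 => w fw pw.
  apply: (@power_product_diff_cvg0 _ _ _ rho_part (fun N => relative_size N ^~ w) (fun=> f ^~ w)).
  - by move=> N k; exact: relative_size01.
  - by move=> _; case: pw.
  - by move=> N; exact: sum_relative_size_le1.
  - by move=> N; exact: (proper_weights_sum_le1 N pw).
  move=> b b0; apply: (@scheffe _ (f ^~ w) (fun N => relative_size N ^~ w)) => //.
  - by case: pw.
  - by move=> N k; exact: relative_size01.
  - by move=> N; exact: (proper_weights_sum_le1 N pw).
  - by move=> N; exact: sum_relative_size_le1.
  - by case: pw.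
have yG : (fun K => Ey K - coarser_prob rho) @ \oo --> (0 : R).
  apply/norm_cvg0P; apply: (squeeze_cvgr _ (cvg_cst 0) (@ffact_ratio_cvg R n)).
  near=> K; rewrite normr_ge0/=; apply: sampled_coarser => //.
    by near: K; exists n.
  by near: K; exists 1%N.
have c : (fun K => (Ep K - Er K) - (Ey K - Ef K) + (Ey K - coarser_prob rho) +
    coarser_prob rho) @ \oo --> (0 : R) - 0 + 0 + coarser_prob rho.
  by apply: cvgD; [apply: cvgD => //; exact: cvgB|exact: cvg_cst].
rewrite subr0 !add0r in c; apply: cvg_trans c.
by apply: near_eq_cvg; apply: nearW => K /=; rewrite rf /Ep; ring.
Unshelve. all: by end_near. Qed.

End kingman.

Section index_partition.
Context (R : realType) (q : seq nat -> R).
Context d0 (Omega0 : measurableType d0) (P0 : probability Omega0 R).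
Context (p r : nat -> {RV P0 >-> R}).
Hypothesis p01 : forall k w, 0 <= p k w <= 1.
Hypothesis p_proper : {ae P0, forall w, proper_weights (p ^~ w)}.
Hypothesis rp : {ae P0, forall w, decreasing_rearrangement (r ^~ w) (p ^~ w)}.
Hypothesis kqr : kingman q r.
Context (n : nat).

Definition index_moment (j : 'I_n -> nat) : R := \int[P0]_w (\prod_i p (j i) w).

Lemma measurable_index_product (j : 'I_n -> nat) :
  measurable_fun setT (fun w => \prod_i p (j i) w).
Proof. by apply: measurable_prod => i _. Qed.

Lemma index_product01 (j : 'I_n -> nat) w : 0 <= \prod_i p (j i) w <= 1.
Proof.
apply/andP; split; first by apply: prodr_ge0 => i _; case/andP: (p01 (j i) w).
by apply: prodr_ile1 => i _; exact: p01.
Qed.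

Lemma index_moment_ge0 j : 0 <= index_moment j.
Proof. by apply: Rintegral_ge0 => w _; case/andP: (index_product01 j w). Qed.

Lemma integrable_index_product (j : 'I_n -> nat) :
  P0.-integrable setT (EFin \o (fun w => \prod_i p (j i) w)).
Proof.
apply: (@integrable_bounded _ _ _ _ _ 1); first exact: measurable_index_product.
by move=> w; have /andP[? ?] := index_product01 j w; rewrite ger0_norm.
Qed.

Definition index_partition_prob K (P : {set {set 'I_n}}) : R :=
  \sum_(j : {ffun 'I_n -> 'I_K} | finset.preim_partition j [set: 'I_n]%SET == P)
    index_moment (fun i => j i).

Lemma upper_index_prob K (rho : {set {set 'I_n}}) : (0 < K)%N ->
  finset.partition rho [set: 'I_n]%SET ->
  \sum_(Q | finset.partition Q [set: 'I_n]%SET && refines (finset.pblock Q) rho)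
    index_partition_prob K Q =
  \int[P0]_w power_product rho K (p ^~ w).
Proof.
move=> K0 rho_part; rewrite /index_partition_prob.
transitivity (\sum_(j : {ffun 'I_n -> 'I_K} | refines j rho) index_moment (fun i => j i)).
  rewrite [RHS](partition_big (fun j : {ffun 'I_n -> 'I_K} =>
      finset.preim_partition j [set: 'I_n]%SET)
    (fun Q => finset.partition Q [set: 'I_n]%SET && refines (finset.pblock Q) rho)) /=.
    apply: eq_bigr => Q /andP[pQ rQ]; apply: eq_bigl => j.
    by case: eqP => [E|]; rewrite ?andbF// refines_kernel E rQ.
  by move=> j; rewrite refines_kernel preim_partitionP.
rewrite -Rintegral_sum; last by move=> j _; exact: integrable_index_product.
apply: Rintegral_ae_eq.
- under eq_fun do rewrite -big_filter.
  by apply: measurable_sum => j; exact: measurable_index_product.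
- by apply: measurable_power_product => k.
apply: filterS p_proper => w pw.
rewrite (power_productE rho_part (fun k => p01 k w)); last exact: (proper_weights_sum_le1 K pw).
by rewrite (prod_power_sums (fun k : 'I_K => p k w) (Ordinal K0) rho_part).
Qed.

(** Both sides have the same sums over coarser partitions, by
    [upper_index_prob] and [power_product_limit]. *)
Theorem index_partition_limit (P : {set {set 'I_n}}) : (0 < n)%N ->
  finset.partition P [set: 'I_n]%SET ->
  index_partition_prob ^~ P @ \oo --> q (block_sizes P).
Proof.
move=> n0 pP.
case: kqr => d1 [W1 [P1 [Pi [f [ranP exP eppf fP fr]]]]].
pose S (u : nat -> R) := u @ \oo --> (0 : R).
have S0 : S 0 by exact: cvg_cst.
have SB x y : S x -> S y -> S (x - y).
  move=> Sx Sy; have c : (fun K => x K - y K) @ \oo --> (0 : R) - 0 by exact: cvgB.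
  by rewrite subrr in c; exact: c.
suff : S (fun K => index_partition_prob K P - q (block_sizes P)).
  move=> SP; rewrite -[X in _ --> X]add0r.
  have c : (fun K => index_partition_prob K P - q (block_sizes P) + q (block_sizes P))
      @ \oo --> 0 + q (block_sizes P) by apply: cvgD => //; exact: cvg_cst.
  apply: cvg_trans c; apply: near_eq_cvg; apply: nearW => K /=; ring.
apply: (upper_refinements_in (a := fun Q K => index_partition_prob K Q - q (block_sizes Q))
  S0 SB _ pP) => rho rho_part.
have lim := power_product_limit ranP exP eppf fP p_proper rp fr n0 rho_part.
set G := \sum_(Q | _ && _) q _ in lim.
have c : (fun K => \int[P0]_w power_product rho K (p ^~ w) - G) @ \oo --> G - G.
  by apply: cvgB => //; exact: cvg_cst.
rewrite subrr in c; rewrite /S; apply: cvg_trans c.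
apply: near_eq_cvg; exists 1%N => // K /= K0.
by rewrite -(upper_index_prob K0 rho_part) /G -sumrB fct_sumE.
Qed.

End index_partition.

(** * Laws of finite samples *)

Section tuple_spaces.
Context d (T : measurableType d) (R : realType).

Definition box n (A : nat -> set T) : set (n.-tuple T) :=
  [set v | forall i : 'I_n, A i (tnth v i)].
Arguments box n A : clear implicits.

Lemma measurable_box n A : (forall i, measurable (A i)) -> measurable (box n A).
Proof.
move=> mA; rewrite (_ : box n A = \big[setI/setT]_(i < n) ((@tnth n T)^~ i @^-1` A i)).
  apply: bigsetI_measurable => i _; rewrite -[X in measurable X]setTI.
  exact: measurable_tnth.
apply/seteqP; split=> v /=; rewrite -bigcap_seq => vA i.
  by move=> _; exact: vA.
by apply: vA; rewrite /= mem_index_enum.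
Qed.

(** The boxes are stable under intersection and generate the product
    sigma-algebra. *)
Lemma eq_tuple_measure n (m1 m2 : {measure set (n.-tuple T) -> \bar R}) :
  (m1 setT < +oo)%E ->
  (forall A, (forall i, measurable (A i)) -> m1 (box n A) = m2 (box n A)) ->
  forall B, measurable B -> m1 B = m2 B.
Proof.
move=> m1oo m12.
pose G := [set B | exists2 A : nat -> set T, forall i, measurable (A i) & B = box n A].
have boxT : box n (fun=> setT) = setT by apply/seteqP; split.
apply: (@measure_unique _ _ _ G (fun=> setT)).
- apply/seteqP; split; last first.
    apply: smallest_sub; first exact: sigma_algebra_measurable.
    by move=> _ [A mA ->]; exact: measurable_box.
  apply: smallest_sub; first exact: smallest_sigma_algebra.
  rewrite -bigcup_seq => B [i _ [C mC <-]]; apply: sub_sigma_algebra.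
  exists (fun k : nat => if k == i :> nat then C else setT).
    by move=> k; case: ifP.
  rewrite setTI; apply/seteqP; split=> v /= => [vC k|/(_ i)]; last by rewrite eqxx.
  by case: ifPn => [/eqP/val_inj ->|].
- move=> _ _ [A mA ->] [C mC ->]; exists (fun i => A i `&` C i).
    by move=> i; exact: measurableI.
  by apply/seteqP; split=> [v [vA vC] i|v vAC]; [split|split=> i; case: (vAC i)].
- by move=> _; exists (fun=> setT).
- by apply/seteqP; split=> // v _; exists 0%N.
- by move=> _ [A mA ->]; exact: m12.
- by [].
Qed.

Context (H : probability T R).

Section cons_law.
Context (n : nat) (m : probability (n.-tuple T) R).

Definition tcons (z : T * n.-tuple T) : n.+1.-tuple T := [tuple of z.1 :: z.2].

Lemma measurable_tcons : measurable_fun setT tcons.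
Proof. exact: (measurable_cons measurable_fst measurable_snd). Qed.

HB.instance Definition _ := isMeasurableFun.Build _ _ _ _ tcons measurable_tcons.

(** The iterated integral that defines [iid_sample_law] is, at each step, the
    image by [tcons] of a product measure. *)
Definition cons_law := pushforward (H \x m)%E tcons.

Let cons_law0 : cons_law set0 = 0%E. Proof. exact: measure0. Qed.
Let cons_law_ge0 A : (0 <= cons_law A)%E. Proof. exact: measure_ge0. Qed.
Let cons_law_sigma_additive : semi_sigma_additive cons_law.
Proof. exact: measure_semi_sigma_additive. Qed.

HB.instance Definition _ := isMeasure.Build _ _ _ cons_law
  cons_law0 cons_law_ge0 cons_law_sigma_additive.

Let cons_law_setT : cons_law setT = 1%E.
Proof.
rewrite /cons_law /pushforward preimage_setT -setXTT product_measure1E//.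
by rewrite -[RHS]mule1; congr (_ * _)%E; exact: probability_setT.
Qed.

HB.instance Definition _ := Measure_isProbability.Build _ _ _ cons_law cons_law_setT.

End cons_law.

(** [iid_sample_law] is a mere set function; on measurable sets it is the
    product probability, determined by its values on boxes. *)
Lemma iid_sample_law_measure n : exists m : probability (n.-tuple T) R,
  (forall A, measurable A -> iid_sample_law H A = m A) /\
  (forall A, (forall i, measurable (A i)) -> m (box n A) = (\prod_(i < n) H (A i))%E).
Proof.
elim: n => [|n [m [mE mbox]]].
  exists (dirac ([tuple] : 0.-tuple T)); split=> // A mA.
  have e : [tuple] \in box 0 A by rewrite inE => -[].
  by rewrite big_ord0 /= /dirac indicE e.
have consE A : measurable A -> iid_sample_law H A = cons_law m A.
  move=> mA; rewrite /= /cons_law /pushforward /product_measure1.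
  apply: eq_integral => x _; rewrite mE.
    by congr (m _); apply/seteqP; split=> v /=; rewrite /xsection/= inE.
  have -> : [set v : n.-tuple T | A [tuple of x :: v]] = xsection (@tcons n @^-1` A) x.
    by apply/seteqP; split=> v /=; rewrite /xsection/= inE.
  apply: measurable_xsection; rewrite -[X in measurable X]setTI.
  exact: measurable_tcons.
exists (cons_law m); split=> // A mA.
have tE : @tcons n @^-1` box n.+1 A = A 0%N `*` box n (fun i => A i.+1).
  apply/seteqP; split=> [[x v] /= xv|[x v] /= [xA vA] i].
    split=> [|i]; first exact: (xv ord0).
    by have := xv (lift ord0 i); rewrite tnthS.
  case: (unliftP ord0 i) => [j ->|->]; last exact: xA.
  by rewrite tnthS; exact: vA.
transitivity ((H \x m)%E (A 0%N `*` box n (fun i => A i.+1))); first by rewrite -tE.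
rewrite product_measure1E//; last by apply: measurable_box => i.
by rewrite big_ord_recl; congr (_ * _)%E; exact: mbox.
Qed.

End tuple_spaces.
Arguments box {d T} n A.

Section samples.
Context d d' (Omega : measurableType d) (T : measurableType d').
Implicit Types (X : nat -> Omega -> T).

Definition sample n X (j : 'I_n -> nat) w : n.-tuple T := [tuple X (j i) w | i < n].

Lemma measurable_sample n X (j : 'I_n -> nat) :
  (forall i, measurable_fun setT (X i)) -> measurable_fun setT (sample X j).
Proof.
move=> mX; apply/measurable_fun_tnthP => i.
rewrite (_ : _ \o _ = X (j i)); first exact: mX.
by apply/funext => w; rewrite /= tnth_mktuple.
Qed.

Lemma preimage_sample_box n X (j : 'I_n -> nat) A :
  sample X j @^-1` box n A = [set w | forall i : 'I_n, A i (X (j i) w)].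
Proof.
by apply/seteqP; split=> w /= wA i; have := wA i; rewrite tnth_mktuple.
Qed.

End samples.

Section iid_samples.
Context (R : realType) d d' (Omega : measurableType d) (T : measurableType d').
Context (P : probability Omega R) (Z : nat -> {RV P >-> T}) (H : probability T R).
Hypothesis ZH : iid Z H.

Lemma iid_sample_box n (j : 'I_n -> nat) A : injective j ->
  (forall i, measurable (A i)) ->
  P (sample Z j @^-1` box n A) = (\prod_(i < n) H (A i))%E.
Proof.
move=> jinj mA; have [marg ind] := ZH.
pose J := [fset x in codom j]%fset.
(* A' transports the sides of the box from positions to indices; it is well
   defined because j is injective. *)
pose A' x : set T := if [pick i | j i == x] is Some i then A (i : 'I_n) else setT.
have A'j (i : 'I_n) : A' (j i) = A i.
  by rewrite /A'; case: pickP => [i' /eqP/jinj ->//|/(_ i)]; rewrite eqxx.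
have mA' x : measurable (A' x) by rewrite /A'; case: pickP.
have bigJ (F : nat -> \bar R) : (\prod_(x <- J) F x = \prod_(i < n) F (j i))%E.
  rewrite (perm_big (codom j))/=; first by rewrite big_map big_enum.
  apply: uniq_perm; [exact: fset_uniq|by apply/injectiveP|].
  by move=> x; rewrite !inE.
transitivity (P (\bigcap_(x in [set` J]) Z x @^-1` A' x)).
  congr (P _); rewrite preimage_sample_box; apply/seteqP; split=> w /= wA.
    by move=> x /=; rewrite !inE => /codomP[i ->]; rewrite A'j; exact: wA.
  move=> i; have := wA (j i); rewrite /= A'j; apply.
  by rewrite !inE codom_f.
rewrite ind// bigJ; apply: eq_bigr => i _; rewrite marg// A'j//.
Qed.

Lemma iid_sample n (j : 'I_n -> nat) B : injective j -> measurable B ->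
  P (sample Z j @^-1` B) = iid_sample_law H B.
Proof.
move=> jinj mB; have [m [-> // mbox]] := iid_sample_law_measure H n.
have mS : measurable_fun setT (sample Z j) by apply: measurable_sample => i.
pose S : {mfun Omega >-> n.-tuple T} := mfun_Sub (mem_set mS).
apply: (@eq_tuple_measure _ _ _ _ (distribution P S) m) => // [|A mA].
  by rewrite (le_lt_trans (probability_le1 _ _)) ?ltry.
by apply: etrans (esym (mbox A mA)); exact: iid_sample_box.
Qed.

End iid_samples.

(** Independence makes the joint law a product measure, and Tonelli's theorem
    separates the two factors. *)
Lemma independent2_integral (R : realType) d d1 d2 (Omega : measurableType d)
    (T1 : measurableType d1) (T2 : measurableType d2) (P : probability Omega R)
    (X : Omega -> T1) (Y : Omega -> T2) (g : T1 -> R) (B : set T2) :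
  measurable_fun setT X -> measurable_fun setT Y -> independent2 P X Y ->
  measurable_fun setT g -> (forall x, 0 <= g x) -> measurable B ->
  (\int[P]_w (g (X w) * \1_B (Y w))%:E = \int[P]_w (g (X w))%:E * P (Y @^-1` B))%E.
Proof.
move=> mX mY XY mg g0 mB.
pose X' : {mfun Omega >-> T1} := mfun_Sub (mem_set mX).
pose Y' : {mfun Omega >-> T2} := mfun_Sub (mem_set mY).
have mXY : measurable_fun setT (fun w => (X w, Y w)) by exact: measurable_fun_pair.
pose XY' : {mfun Omega >-> (T1 * T2)%type} := mfun_Sub (mem_set mXY).
pose f (z : T1 * T2) : \bar R := (g z.1 * \1_B z.2)%:E.
have mf : measurable_fun setT f.
  apply/measurable_EFinP; apply: measurable_funM.
    exact: measurableT_comp mg measurable_fst.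
  exact: measurableT_comp (measurable_indic mB) measurable_snd.
have f0 z : (0 <= f z)%E by rewrite lee_fin mulr_ge0.
have mg' : measurable_fun setT (EFin \o g) by exact/measurable_EFinP.
transitivity (\int[distribution P XY']_z f z)%E.
  by rewrite ge0_integral_distribution.
transitivity (\int[distribution P X' \x distribution P Y']_z f z)%E.
  apply: eq_measure_integral => C mC _; apply/esym.
  by apply: product_measure_unique.
rewrite fubini_tonelli1//.
transitivity (\int[distribution P X']_x ((g x)%:E * P (Y @^-1` B)))%E.
  apply: eq_integral => x _; rewrite /fubini_F /f.
  transitivity (\int[distribution P Y']_y ((g x)%:E * (\1_B y)%:E))%E; first by [].
  have mB1 : measurable_fun setT (fun y => (\1_B y)%:E : \bar R).
    by apply/measurable_EFinP; exact: measurable_indic.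
  by rewrite ge0_integralZl ?lee_fin// integral_indic// setIT.
rewrite ge0_integralZr//; last by move=> x _; rewrite lee_fin.
by rewrite ge0_integral_distribution// => x; rewrite lee_fin.
Qed.

(** * Sampling from a random discrete measure *)

Lemma measurable_evaluation (R : realType) d (T : measurableType d) (A : set T) :
  measurable A ->
  measurable_fun setT (fun nu : pprobability T R => fine ((nu : probability T R) A)).
Proof.
move=> mA; apply: measurableT_comp; first exact: fine_measurable.
have mid : measurable_fun setT (@id (pprobability T R)) by exact: measurable_id.
exact: (measurable_kernel (kprobability mid)).
Qed.

Lemma prod_indic (R : realType) (S : Type) (I : finType) (A : I -> set S) (x : I -> S) :
  \prod_i \1_(A i) (x i) = ((\prod_i (x i \in A i)))%:R :> R.
Proof. by rewrite natr_prod. Qed.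

Section mixtures.
Context (R : realType) d (T : measurableType d).
Context d1 (Omega : measurableType d1) (P : probability Omega R).
Context (xi : nat -> {RV P >-> T}) (mu : {RV P >-> pprobability T R}).
Context d0 (Omega0 : measurableType d0) (P0 : probability Omega0 R).
Context (p : nat -> {RV P0 >-> R}) (Z : nat -> {RV P0 >-> T}).
Context (Q : {RV P0 >-> pprobability T R}).
Hypothesis xi_mu : conditionally_iid xi mu.
Hypothesis p01 : forall k w, 0 <= p k w <= 1.
Hypothesis p_proper : {ae P0, forall w, proper_weights (p ^~ w)}.
Hypothesis pZ : independent2 P0 (trajectory p) (trajectory Z).
Hypothesis QE : {ae P0, forall w, forall A : set T, measurable A ->
  ((Q w : probability T R) A = \sum_(0 <= j <oo) (p j w)%:E * \d_(Z j w) A)%E}.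
Hypothesis muQ : eq_law P P0 mu Q.
Context (n : nat).

Definition first_sample : Omega -> n.-tuple T := sample xi (fun i : 'I_n => i).

(** The part of the law of [n] observations carried by indices below [K]. *)
Definition mixture K (B : set (n.-tuple T)) : R :=
  \sum_(j : {ffun 'I_n -> 'I_K})
    index_moment p (fun i => j i) * fine (P0 (sample Z (fun i => j i) @^-1` B)).

(** The moment depends on the weights and the event on the atoms.  Clamping
    makes the product of weights nonnegative for every sequence, and does not
    change the value at the trajectory of [p]. *)
Lemma moment_box (j : 'I_n -> nat) (A : nat -> set T) : (forall i, measurable (A i)) ->
  \int[P0]_w (\prod_(i < n) (p (j i) w * \1_(A i) (Z (j i) w))) =
  index_moment p j * fine (P0 (sample Z j @^-1` box n A)).
Proof.
move=> mA; pose B := [set s : sequences T | forall i : 'I_n, A i (s (j i))].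
have mB : measurable B.
  rewrite (_ : B = \bigcap_(i : 'I_n) ((fun s : sequences T => s (j i)) @^-1` A i)).
    apply: fin_bigcap_measurable => // i _; rewrite -[X in measurable X]setTI.
    exact: measurable_coordinate.
  by apply/seteqP; split=> [s sB i _|s sB i]; [exact: sB|exact: (sB i I)].
pose g (s : sequences R) : R := \prod_(i < n) clamp (s (j i)).
have mg : measurable_fun setT g.
  apply: measurable_prod => i _; apply: measurable_maxr => //.
  by apply: measurable_minr => //; exact: measurable_coordinate.
have g0 s : 0 <= g s by apply: prodr_ge0 => i _; case/andP: (clamp01 (s (j i))).
have mp : measurable_fun setT (trajectory p) by apply: measurable_trajectory => k.
have mZ : measurable_fun setT (trajectory Z) by apply: measurable_trajectory => k.
have gp w : g (trajectory p w) = \prod_i p (j i) w.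
  by apply: eq_bigr => i _; rewrite clampE// p01.
have BZ : trajectory Z @^-1` B = sample Z j @^-1` box n A.
  by rewrite preimage_sample_box.
have gpE : (\int[P0]_w (g (trajectory p w))%:E = \int[P0]_w (\prod_i p (j i) w)%:E)%E.
  by apply: eq_integral => w _; rewrite gp.
have := independent2_integral mp mZ pZ mg g0 mB.
rewrite BZ gpE => /(congr1 fine); rewrite fineM; last 2 first.
- exact: integrable_fin_num (integrable_index_product p01 j).
- by rewrite fin_num_measure// -BZ -[X in measurable X]setTI; exact: mZ.
move=> <-; apply: eq_Rintegral => w _; rewrite gp big_split/=; congr (_ * _).
rewrite prod_indic indicE; congr (_%:R).
have [wB|wB] := boolP (trajectory Z w \in B).
  by rewrite big1// => i _; rewrite mem_set//; move: wB; rewrite inE; apply.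
apply/eqP; rewrite -leqn0 leqNgt; apply: contra wB => wB; rewrite inE => i.
by apply/set_mem; move: wB; rewrite (bigD1 i)//=; case: (_ \in _).
Qed.

Lemma first_sample_box (A : nat -> set T) : (forall i, measurable (A i)) ->
  fine (P (first_sample @^-1` box n A)) =
  \int[P0]_w \prod_(i < n) fine ((Q w : probability T R) (A i)).
Proof.
move=> mA; have := xi_mu n mA (@measurableT _ (pprobability T R)).
rewrite preimage_setT setTI.
have -> : \bigcap_(i in `I_n) xi i @^-1` A i = first_sample @^-1` box n A.
  rewrite preimage_sample_box; apply/seteqP; split=> w wA i; first exact: (wA i (ltn_ord i)).
  by move=> /= i_n; exact: (wA (Ordinal i_n)).
move=> ->.
pose g (nu : pprobability T R) : R := \prod_(i < n) fine ((nu : probability T R) (A i)).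
have mg : measurable_fun setT g.
  by apply: measurable_prod => i _; exact: measurable_evaluation.
have g0 nu : 0 <= g nu by apply: prodr_ge0 => i _; exact: fine_ge0.
transitivity (\int[P]_w g (mu w)).
  congr fine; apply: eq_integral => w _; rewrite /g.
  rewrite -prodEFin; apply: eq_bigr => i _; rewrite fineK//.
  exact: fin_num_measure.
by apply: eq_law_Rintegral => //.
Qed.

(** Conditional independence gives the expectation of [\prod_i Q (A i)].  Each
    [Q (A i)] is the limit of its partial sums over the atoms, and expanding
    the product of the partial sums gives the mixture.  Partial sums are
    replaced by their minimum with 1 to have a bound everywhere. *)
Lemma mixture_box (A : nat -> set T) : (forall i, measurable (A i)) ->
  (fun K => mixture K (box n A)) @ \oo --> fine (P (first_sample @^-1` box n A)).
Proof.
move=> mA; rewrite first_sample_box//.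
pose G i K w : R := \sum_(k < K) p k w * \1_(A i) (Z k w).
have mterm k i : measurable_fun setT (fun w => p k w * \1_(A i) (Z k w)).
  apply: measurable_funM => //.
  by apply: (@measurableT_comp _ _ _ _ _ _ (\1_(A i) : T -> R)) => //; exact: measurable_indic.
have term01 k i w : 0 <= p k w * \1_(A i) (Z k w) <= 1.
  have /andP[p0 p1] := p01 k w.
  by rewrite indicE; case: (_ \in _); rewrite ?mulr1 ?mulr0 ?lexx ?ler01 ?p0 ?p1.
have G0 i K w : 0 <= G i K w by apply: sumr_ge0 => k _; case/andP: (term01 k i w).
have mixE K : mixture K (box n A) = \int[P0]_w (\prod_(i < n) G i K w).
  under eq_Rintegral do rewrite bigA_distr_bigA/=.
  rewrite Rintegral_sum; last first.
    move=> j _; apply: (@integrable_bounded _ _ _ _ _ 1).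
      by apply: measurable_prod => i _.
    move=> w; rewrite ger0_norm; last by apply: prodr_ge0 => i _; case/andP: (term01 (j i) i w).
    by apply: prodr_ile1 => i _; exact: term01.
  by apply: eq_bigr => j _; rewrite -moment_box.
have mG i K : measurable_fun setT (G i K) by apply: measurable_sum => k.
have GQ : {ae P0, forall w, forall i K, G i K w <= 1 /\
    (G i ^~ w @ \oo --> fine ((Q w : probability T R) (A i)))}.
  move: p_proper QE; apply: filterS2 => w pw Qw i K; split.
    apply: le_trans (proper_weights_sum_le1 K pw); apply: ler_sum => k _.
    have /andP[p0 _] := p01 k w.
    by rewrite indicE; case: (_ \in _); rewrite ?mulr1 ?mulr0.
  apply: (@nneseries_cvg_fin _ (fun k => p k w * \1_(A i) (Z k w))) => [k|].
    by case/andP: (term01 k i w).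
  rewrite fineK; last exact: fin_num_measure.
  by rewrite Qw//; apply: eq_eseriesr => k _; rewrite EFinM.
pose M K w := \prod_(i < n) Num.min 1 (G i K w).
have min01 i K w : 0 <= Num.min 1 (G i K w) <= 1.
  by rewrite le_min ler01 ge_min lexx G0.
have Q01 i w : 0 <= fine ((Q w : probability T R) (A i)) <= 1.
  rewrite fine_ge0//= -lee_fin fineK; first exact: probability_le1.
  exact: fin_num_measure.
have mM K : measurable_fun setT (M K).
  by apply: measurable_prod => i _; apply: measurable_minr => //; exact: measurable_cst.
have mQ : measurable_fun setT (fun w => \prod_(i < n) fine ((Q w : probability T R) (A i))).
  apply: measurable_prod => i _.
  by apply: (measurableT_comp (measurable_evaluation (mA i))).
have prod01 (u : 'I_n -> R) : (forall i, 0 <= u i <= 1) -> `|\prod_i u i| <= 1.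
  move=> u01; rewrite ger0_norm; last by apply: prodr_ge0 => i _; case/andP: (u01 i).
  exact: prodr_ile1.
have c : (fun K => \int[P0]_w M K w -
    \int[P0]_w \prod_(i < n) fine ((Q w : probability T R) (A i))) @ \oo --> (0 : R).
  apply: (@Rintegral_diff_cvg0 _ _ _ P0 M
    (fun _ w => \prod_(i < n) fine ((Q w : probability T R) (A i))) 1) => //.
  - by move=> K w; exact: prod01.
  - by move=> K w; exact: prod01.
  apply: filterS GQ => w Gw.
  apply: (@prod_diff_cvg0 _ _ _ (fun K (i : 'I_n) => Num.min 1 (G i K w))
    (fun _ (i : 'I_n) => fine ((Q w : probability T R) (A i)))) => // i _.
  rewrite -(subrr (fine ((Q w : probability T R) (A i)))); apply: cvgB; last exact: cvg_cst.
  apply: cvg_trans (Gw i 0%N).2; apply: near_eq_cvg; apply: nearW => K /=.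
  by rewrite (min_idPr _)//; exact: (Gw i K).1.
rewrite -[X in _ --> X]add0r.
have c' := cvgD c (cvg_cst (\int[P0]_w \prod_(i < n) fine ((Q w : probability T R) (A i)))).
apply: cvg_trans (c' _ _); apply: near_eq_cvg; apply: nearW => K.
rewrite mixE /= fctE/= subrK; apply: Rintegral_ae_eq => //.
  by apply: measurable_prod => i _.
apply: filterS GQ => w Gw; apply: eq_bigr => i _.
by rewrite (min_idPr _)//; exact: (Gw i K).1.
Qed.

Hypothesis n_gt0 : (0 < n)%N.

(** An index vector with entries at most [K] either has all its entries below
    [K] or attains [K]. *)
Lemma mixture_increment K (phi : ('I_n -> nat) -> R) :
  \sum_(j : {ffun 'I_n -> 'I_K.+1}) phi (fun i => j i) =
  \sum_(j : {ffun 'I_n -> 'I_K}) phi (fun i => j i) +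
  \sum_(j : {ffun 'I_n -> 'I_K.+1} | [exists i, j i == ord_max]) phi (fun i => j i).
Proof.
rewrite (bigID (fun j : {ffun 'I_n -> 'I_K.+1} => [exists i, j i == ord_max]))/= addrC.
congr (_ + _).
pose wid (j : {ffun 'I_n -> 'I_K}) : {ffun 'I_n -> 'I_K.+1} :=
  [ffun i => widen_ord (leqnSn K) (j i)].
transitivity (\sum_(j in [set wid j | j in [set: {ffun 'I_n -> 'I_K}]]%SET) phi (fun i => j i)).
  apply: eq_bigl => j; apply/idP/imsetP => [/existsPn jK|[j' _ ->]].
    have lt i : (j i < K)%N.
      by have := jK i; rewrite -val_eqE/= ltn_neqAle -ltnS ltn_ord => ->.
    exists [ffun i => Ordinal (lt i)]; first by rewrite inE.
    by apply/ffunP => i; rewrite !ffunE; apply/val_inj.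
  by apply/existsPn => i; rewrite ffunE -val_eqE/= ltn_eqF// ltn_ord.
rewrite big_imset/=; last first.
  move=> j1 j2 _ _ /ffunP j12; apply/ffunP => i; have := j12 i.
  by rewrite !ffunE => /(congr1 val) /= E; apply/val_inj.
apply: eq_big => [j|j _]; first by rewrite inE.
by congr phi; apply/funext => i; rewrite ffunE.
Qed.

Let mS (j : 'I_n -> nat) : measurable_fun setT (sample Z j).
Proof. by apply: measurable_sample => i. Qed.

Let S (j : 'I_n -> nat) : {mfun Omega0 >-> n.-tuple T} := mfun_Sub (mem_set (mS j)).

Let weight (j : 'I_n -> nat) : {nonneg R} := NngNum (index_moment_ge0 p01 j).

Let mT := {measure set (n.-tuple T) -> \bar R}.
Let addm (m1 m2 : mT) : mT := measure_add m1 m2.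
Let zerom : mT := mzero.
Let component (j : 'I_n -> nat) : mT := mscale (weight j) (distribution P0 (S j)).

(** The components whose largest index is [L].  Splitting the mixture into
    levels exhibits its limit as a countable sum of measures. *)
Definition mixture_level L : mT :=
  \big[addm/zerom]_(j : {ffun 'I_n -> 'I_L.+1} | [exists i, j i == ord_max])
    component (fun i => j i).

Lemma sum_mixture_level K B : measurable B ->
  (\sum_(0 <= L < K) mixture_level L B)%E = (mixture K B)%:E.
Proof.
move=> mB.
have levelE L : mixture_level L B =
    (\sum_(j : {ffun 'I_n -> 'I_L.+1} | [exists i, j i == ord_max])
       index_moment p (fun i => j i) * fine (P0 (sample Z (fun i => j i) @^-1` B)))%:E.
  rewrite /mixture_level (big_morph (fun m : mT => m B) (id1 := 0%E) (op1 := +%E))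
    => [|m1 m2|]; last 2 first.
  - exact: measure_addE.
  - by [].
  rewrite -sumEFin; apply: eq_bigr => j _; rewrite EFinM.
  rewrite [X in (_ * X)%E]fineK// fin_num_measure// -[X in measurable X]setTI.
  exact: mS.
elim: K => [|K IHK].
  rewrite big_geq// /mixture big_pred0// => j; apply/negbTE/negP => _.
  by case: (j (Ordinal n_gt0)).
rewrite big_nat_recr//= IHK levelE -EFinD; congr EFin; apply/esym.
exact: (mixture_increment K (fun j => index_moment p j * fine (P0 (sample Z j @^-1` B)))).
Qed.

(** The limit of the mixtures and the law of the observations are measures, so
    their equality extends from boxes to all measurable sets. *)
Theorem mixture_limit B : measurable B ->
  mixture ^~ B @ \oo --> fine (P (first_sample @^-1` B)).
Proof.
move=> mB; have mF : measurable_fun setT first_sample by apply: measurable_sample => i.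
pose F : {mfun Omega >-> n.-tuple T} := mfun_Sub (mem_set mF).
pose m2 := mseries mixture_level 0.
have m2E C : measurable C -> (fun K => (mixture K C)%:E) @ \oo --> m2 C.
  move=> mC; rewrite (_ : (fun _ => _) = fun K => (\sum_(0 <= L < K) mixture_level L C)%E).
    by apply: is_cvg_nneseries => L _ _; exact: measure_ge0.
  by apply/funext => K; rewrite sum_mixture_level.
have Pfin C : measurable C -> (P (first_sample @^-1` C)) \is a fin_num.
  by move=> mC; rewrite fin_num_measure// -[X in measurable X]setTI; exact: (mF _ C mC).
have m12 : P (first_sample @^-1` B) = m2 B.
  apply: (@eq_tuple_measure _ _ _ _ (distribution P F) m2) => // [|A mA].
    by rewrite (le_lt_trans (probability_le1 _ _)) ?ltry.
  have mbA := @measurable_box _ _ n _ mA.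
  apply/esym/(cvg_unique _ (m2E _ mbA)) => //.
  have c : (fun K => (mixture K (box n A))%:E) @ \oo --> (fine (P (first_sample @^-1` box n A)))%:E.
    by apply: cvg_EFin; [exact: nearW|exact: mixture_box].
  by rewrite fineK ?Pfin in c.
by have := m2E _ mB; rewrite -m12 -[P _](fineK (Pfin _ mB)) => /fine_cvg.
Qed.

End mixtures.

(** * Coincidence patterns *)

(** The balls of radius [1 / (m + 1)] about the points of a countable dense set
    separate points; such a family makes the equality of two coordinates
    measurable. *)
Lemma polish_separating (R : realType) (X : ptopologicalType) : polish R X ->
  exists B : nat -> set X, (forall k, open (B k)) /\
    forall x y, (forall k, B k x <-> B k y) -> x = y.
Proof.
move=> [[D cD dD] [dist [[dist0 dist_eq dist_sym dist_tri] nbhsE _]]].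
have /countable_injP[code code_inj] := cD.
have ball_open x e : open [set y | dist x y < e].
  rewrite openE => y /= xy; apply/nbhsE; exists (e - dist x y).
    by rewrite subr_gt0.
  by move=> z /= yz; rewrite (le_lt_trans (dist_tri x y z))// -ltrBrDl.
pose B (k : nat) : set X := if (choice.unpickle k : option (nat * nat)) is Some (i, m) then
  \bigcup_(c in [set c | D c /\ code c = i]) [set y | dist c y < m.+1%:R^-1] else set0.
exists B; split=> [k|x y xyB].
  rewrite /B; case: choice.unpickle => [[i m]|]; last exact: open0.
  by apply: bigcup_open => c _; exact: ball_open.
apply/dist_eq/eqP; rewrite eq_le dist0 andbT leNgt; apply/negP => xy0.
have [m me] : exists m : nat, m.+1%:R^-1 < dist x y / 2.
  have e0 : 0 < dist x y / 2 by rewrite divr_gt0.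
  have /cvgrPdist_lt/(_ _ e0)[m _ /(_ m (leqnn _))/=] := @cvg_harmonic R.
  by rewrite sub0r normrN ger0_norm ?invr_ge0//; exists m.
have [c [/= xc Dc]] : [set z | dist x z < m.+1%:R^-1] `&` D !=set0.
  apply: dD => //; exists x => /=.
  by rewrite (_ : dist x x = 0) ?invr_gt0//; apply/dist_eq.
have : B (choice.pickle (code c, m)) x.
  by rewrite /B choice.pickleK; exists c => //=; rewrite dist_sym.
move/xyB; rewrite /B choice.pickleK => -[c' [Dc' cc'] /= c'y].
have E : c' = c by apply: code_inj; rewrite ?inE.
rewrite E in c'y; have := dist_tri x c y; apply/negP; rewrite -ltNge.
rewrite [dist x y]splitr; apply: ltrD; exact: lt_trans me.
Qed.


Section patterns.
Context d (T : measurableType d) (B : nat -> set T).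
Hypotheses (mB : forall k, measurable (B k))
  (sepB : forall x y, (forall k, B k x <-> B k y) -> x = y).

Definition pattern n (L : Type) (f : 'I_n -> L) : set (n.-tuple T) :=
  [set v | forall a b, tnth v a = tnth v b <-> f a = f b].

Lemma measurable_coincidence n (a b : 'I_n) :
  measurable [set v : n.-tuple T | tnth v a = tnth v b].
Proof.
have mt i k : measurable [set v : n.-tuple T | B k (tnth v i)].
  by rewrite -[X in measurable X]setTI; exact: measurable_tnth.
rewrite (_ : [set _ | _] = \bigcap_k
    (([set v | B k (tnth v a)] `&` [set v | B k (tnth v b)]) `|`
     (~` [set v | B k (tnth v a)] `&` ~` [set v | B k (tnth v b)]))).
  apply: bigcapT_measurable => k.
  by apply: measurableU; apply: measurableI => //; exact: measurableC.
apply/seteqP; split=> [v /= ab k _|v /= vB].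
  rewrite /= ab; by have [?|?] := pselect (B k (tnth v b)); [left|right].
by apply: sepB => k; case: (vB k I) => -[].
Qed.

Lemma measurable_pattern n (L : Type) (f : 'I_n -> L) : measurable (pattern f).
Proof.
rewrite (_ : pattern f = \bigcap_(a : 'I_n) \bigcap_(b : 'I_n)
    [set v | tnth v a = tnth v b <-> f a = f b]); last first.
  by apply/seteqP; split=> v /= vf a; [move=> _ b _|move=> b]; apply: vf.
apply: fin_bigcap_measurable => // a _; apply: fin_bigcap_measurable => // b _.
have [fab|fab] := pselect (f a = f b).
  rewrite (_ : [set _ | _] = [set v | tnth v a = tnth v b]); first exact: measurable_coincidence.
  by apply/seteqP; split=> v /=; tauto.
rewrite (_ : [set _ | _] = ~` [set v | tnth v a = tnth v b]).
  by apply: measurableC; exact: measurable_coincidence.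
by apply/seteqP; split=> v /=; tauto.
Qed.

Section sample_pattern.
Context (R : realType) d0 (Omega0 : measurableType d0) (P0 : probability Omega0 R).
Context (Z : nat -> {RV P0 >-> T}) (H : probability T R).
Hypothesis ZH : iid Z H.
Context (n k : nat) (c : 'I_n -> 'I_k) (ns : 'I_k -> nat).
Hypothesis card_fibre : forall i, #|fibre c i| = ns i.

(** Pick an element [X a] in each block of [P], the blocks being listed fibre
    by fibre; the indices [j (X a)] are distinct, so the corresponding draws
    are independent with law [H].  The block at position [a] lies in the fibre
    numbered [reshape_index ms a], whence the event in [Hsharp]. *)
Lemma sample_pattern_refines (j : 'I_n -> nat) :
  let P := finset.preim_partition j [set: 'I_n]%SET in refines c P ->
  P0 (sample Z j @^-1` pattern c) = Hsharp H [seq (multiplicities c ns P i : nat) | i : 'I_k].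
Proof.
move=> P rP; have pP : finset.partition P [set: 'I_n]%SET by exact: preim_partitionP.
set ms := [seq _ | i : 'I_k].
pose ss := [seq enum (blocks_in c P i) | i : 'I_k].
have ssE : shape ss = ms.
  rewrite /shape /ss /ms -map_comp; apply: eq_map => i /=.
  by rewrite (multiplicitiesE card_fibre pP rP) cardE.
have size_ss : size ss = k by rewrite size_map -cardE card_ord.
have ubs : uniq (flatten ss).
  by rewrite (perm_uniq (perm_blocks_in pP rP)) enum_uniq.
have szbs : size (flatten ss) = sumn ms by rewrite size_flatten ssE.
have /choice[X XP] : forall a : 'I_(sumn ms), exists x,
    finset.pblock P x = nth finset.set0 (flatten ss) a /\ reshape_index ms a = c x.
  move=> a; have am : (a < sumn (shape ss))%N by rewrite ssE.
  have ik := reshape_indexP am; rewrite size_map size_ss in ik.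
  pose i := Ordinal ik.
  have Bi : nth finset.set0 (flatten ss) a \in blocks_in c P i.
    rewrite nth_flatten; have := reshape_offsetP am.
    rewrite (nth_map [::]) ?size_ss// => off.
    rewrite -mem_enum (_ : enum (blocks_in c P i) = nth [::] ss (reshape_index (shape ss) a)).
      exact: mem_nth.
    rewrite (_ : reshape_index (shape ss) a = i)// /ss.
    by rewrite (nth_map i) -?cardE ?card_ord// nth_ord_enum.
  have BP : nth finset.set0 (flatten ss) a \in P by move: Bi; rewrite inE => /andP[].
  have /set0Pn[x xB] := partition_neq0 pP BP.
  exists x; split; first exact: def_pblock (partition_trivIset pP) BP xB.
  by move: Bi; rewrite (mem_blocks_in _ pP rP xB) => /andP[_ /eqP ->]; rewrite /= ssE.
have jX x y : (finset.pblock P x == finset.pblock P y) = (j x == j y) by exact: pblock_kernel.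
have cX x y : j x = j y -> c x = c y.
  move=> /eqP; rewrite -jX -mem_same_pblock// => xy.
  by have /forallP/(_ x)/forallP/(_ y) := rP; rewrite xy => /eqP.
pose t a := j (X a).
have tinj : injective t.
  move=> a b /eqP; rewrite -jX (XP a).1 (XP b).1 nth_uniq ?szbs// => /eqP.
  exact: val_inj.
have cover x : exists a, j x = t a /\ c x = c (X a).
  have xb : finset.pblock P x \in flatten ss.
    by rewrite (perm_mem (perm_blocks_in pP rP)) mem_enum pblock_mem// (cover_partition pP) inE.
  have am : (index (finset.pblock P x) (flatten ss) < sumn ms)%N by rewrite -szbs index_mem.
  have E : j x = t (Ordinal am) by apply/eqP; rewrite -jX (XP _).1/= nth_index.
  by exists (Ordinal am); split=> //; exact: cX.
rewrite /Hsharp -/(pattern (fun a : 'I_(sumn ms) => reshape_index ms a)).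
rewrite -(iid_sample ZH tinj (measurable_pattern _)); congr (P0 _).
apply/seteqP; split=> w /= wp a b; rewrite !tnth_mktuple.
  have := wp (X a) (X b); rewrite !tnth_mktuple (XP a).2 (XP b).2 => ->.
  by split=> [->//|/val_inj].
have [a' [-> ->]] := cover a; have [b' [-> ->]] := cover b.
have := wp a' b'; rewrite !tnth_mktuple (XP a').2 (XP b').2 => ->.
by split=> [/val_inj|->].
Qed.

Lemma sample_pattern_nrefines (j : 'I_n -> nat) :
  ~~ refines c (finset.preim_partition j [set: 'I_n]%SET) ->
  P0 (sample Z j @^-1` pattern c) = 0%E.
Proof.
rewrite negb_forall => /existsP[x]; rewrite negb_forall => /existsP[y].
rewrite negb_imply mem_same_pblock ?preim_partitionP// pblock_kernel.
move=> /andP[/eqP jxy /eqP cxy].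
rewrite (_ : _ @^-1` _ = set0) ?measure0//; apply/seteqP; split=> // w /= wp.
by apply: cxy; apply/wp; rewrite !tnth_mktuple jxy.
Qed.

End sample_pattern.

End patterns.

Section limit_law.
Context (R : realType) d (T : measurableType d) (B : nat -> set T).
Hypotheses (mB : forall k, measurable (B k))
  (sepB : forall x y, (forall k, B k x <-> B k y) -> x = y).
Context (q : seq nat -> R) (H : probability T R).
Context d1 (Omega : measurableType d1) (P : probability Omega R).
Context (xi : nat -> {RV P >-> T}) (xi_gSSS : gSSS q H xi).
Context (n k : nat) (c : 'I_n -> 'I_k) (ns : 'I_k -> nat).
Hypotheses (n_gt0 : (0 < n)%N) (card_fibre : forall i, #|fibre c i| = ns i)
  (ns_gt0 : forall i, (0 < ns i)%N).

Lemma Hsharp_fin ms : Hsharp H ms \is a fin_num.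
Proof.
have [m [mE _]] := iid_sample_law_measure H (sumn ms).
rewrite /Hsharp mE; last exact: (measurable_pattern mB sepB).
by rewrite fin_num_measure//; exact: (measurable_pattern mB sepB).
Qed.

(** In the limit of the mixtures for the pattern [c], the index vectors are
    grouped by their level sets [S]; only the [S] that refine [c] count. *)
Lemma gSSS_pattern :
  (P (sample xi (fun i : 'I_n => i : nat) @^-1` pattern c) =
  \sum_(m in Mset ns) Hsharp H [seq (m i : nat) | i : 'I_k] *
    \sum_(l in Lambda m) (coefc R l * qtilde q l)%:E)%E.
Proof.
case: xi_gSSS => mu [xi_mu [d0 [W0 [P0 [p [Z [Q [r [[p01 p1 ZH pZ] QE muQ rp kqr]]]]]]]]].
have pp : {ae P0, forall w, proper_weights (p ^~ w)}.
  apply: filterS p1 => w pw; apply: proper_weightsP => // j.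
  by case/andP: (p01 j w).
have mpat := measurable_pattern mB sepB c.
have lim := mixture_limit xi_mu p01 pp pZ QE muQ n_gt0 mpat.
have qsym : symmetric_function q by case: kqr => ? [? [? [? [? [_ _ [] ]]]]].
pose h (m : {dffun forall i : 'I_k, 'I_(ns i).+1}) : R :=
  fine (Hsharp H [seq (m i : nat) | i : 'I_k]).
pose hP S : R := if refines c S then h (multiplicities c ns S) else 0.
have mixE K : mixture p Z K (pattern c) =
    \sum_(S | finset.partition S [set: 'I_n]%SET) index_partition_prob p K S * hP S.
  rewrite /mixture (partition_big (fun j : {ffun 'I_n -> 'I_K} =>
      finset.preim_partition j [set: 'I_n]%SET)
    (fun S => finset.partition S [set: 'I_n]%SET))/=; last first.
    by move=> j _; exact: preim_partitionP.
  apply: eq_bigr => S _; rewrite mulr_suml; apply: eq_bigr => j /eqP jS.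
  congr (_ * _); rewrite /hP -jS; case: ifPn => [rj|nrj].
    by rewrite (sample_pattern_refines mB sepB ZH card_fibre rj).
  by rewrite (sample_pattern_nrefines Z nrj).
have lim' : (fun K => mixture p Z K (pattern c)) @ \oo -->
    \sum_(S | finset.partition S [set: 'I_n]%SET) q (block_sizes S) * hP S.
  rewrite (_ : (fun _ => _) = fun K => \sum_(S | finset.partition S [set: 'I_n]%SET)
      index_partition_prob p K S * hP S); last by apply/funext => K; exact: mixE.
  apply: cvg_sum_ord => S pS; apply: cvgM; last exact: cvg_cst.
  exact: (index_partition_limit p01 pp rp kqr n_gt0 pS).
have E := cvg_unique (@Rhausdorff R) lim lim'.
rewrite -[LHS]fineK ?E; last first.
  rewrite fin_num_measure// -[X in measurable X]setTI.
  by apply: measurable_sample => // i.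
rewrite (_ : \sum_(S | _) _ = \sum_(S | finset.partition S [set: 'I_n]%SET && refines c S)
    h (multiplicities c ns S) * q (block_sizes S)); last first.
  rewrite [RHS]big_mkcondr/=; apply: eq_bigr => S _.
  by rewrite /hP; case: ifP; rewrite ?mulr0// mulrC.
rewrite (sum_refinements card_fibre ns_gt0 h qsym) -sumEFin; apply: eq_bigr => m _.
by rewrite EFinM fineK ?Hsharp_fin// -sumEFin.
Qed.

End limit_law.

Local Open Scope ereal_scope.

Theorem proposition3 (R : realType) (X : ptopologicalType)
    (polishX : polish R X)
    (H : probability (borel X) R)
    (q : seq nat -> R) (eppf_q : is_eppf q)
    (d : measure_display) (Omega : measurableType d) (P : probability Omega R)
    (xi : nat -> {RV P >-> borel X}) (xi_gSSS : gSSS q H xi)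
    (n : nat) (n_gt0 : (0 < n)%N)
    (pi : {set {set 'I_n}}) (partition_pi : finset.partition pi [set: 'I_n]%SET)
    (k : nat) (pis : k.-tuple {set 'I_n}) (blocks_pi : blocks pi = pis)
    (ns : 'I_k -> nat) (card_pis : forall i, #|tnth pis i| = ns i) :
  P [set w | induced_partition (fun i => xi i w) n = pi] =
  \sum_(m in Mset ns) Hsharp H [seq (m i : nat) | i : 'I_k] *
    \sum_(l in Lambda m) (coefc R l * qtilde q l)%:E.
Proof.
have [B [oB sepB]] := polish_separating polishX.
have mB k' : measurable (B k' : set (borel X)) by exact: sub_sigma_algebra.
have upis : uniq pis by rewrite -blocks_pi sort_uniq enum_uniq.
have mem_pis A : (A \in (pis : seq _)) = (A \in pi).
  by rewrite -blocks_pi mem_sort mem_enum.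
have pi_tnth i : tnth pis i \in pi by rewrite -mem_pis mem_tnth.
have /choice[c cP] : forall x : 'I_n, exists i, tnth pis i = finset.pblock pi x.
  move=> x; have : finset.pblock pi x \in (pis : seq _).
    by rewrite mem_pis pblock_mem// (cover_partition partition_pi) inE.
  by move=> /tnthP[i ->]; exists i.
have tnth_inj : injective (tnth pis) by apply/tuple_uniqP.
have in_pblock x : x \in finset.pblock pi x.
  by rewrite mem_pblock (cover_partition partition_pi) inE.
have fibE i : fibre c i = tnth pis i.
  apply/setP => x; rewrite inE; apply/eqP/idP => [<-|xi']; first by rewrite cP.
  by apply: tnth_inj; rewrite cP (def_pblock (partition_trivIset partition_pi) _ xi').
have card_fibre i : #|fibre c i| = ns i by rewrite fibE.
have ns_gt0 i : (0 < ns i)%N.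
  by rewrite -card_pis card_gt0 (partition_neq0 partition_pi).
rewrite -(gSSS_pattern mB sepB xi_gSSS n_gt0 card_fibre ns_gt0); congr (P _).
have c_pblock x y : (c x = c y) <-> finset.pblock pi x = finset.pblock pi y.
  by split=> [xy|]; [rewrite -!cP xy|rewrite -!cP => /tnth_inj].
apply/seteqP; split=> w /=.
  move/eqP; rewrite (kernel_eq (fun i : 'I_n => xi i w) partition_pi) => /forallP wpi x y.
  have /forallP/(_ y)/eqP := wpi x; rewrite !tnth_mktuple => E.
  rewrite c_pblock; split=> [/eqP|/eqP]; [rewrite E|rewrite -E]; exact: eqP.
move=> wc; apply/eqP; rewrite (kernel_eq (fun i : 'I_n => xi i w) partition_pi).
apply/forallP => x; apply/forallP => y; have := wc x y; rewrite !tnth_mktuple c_pblock => E.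
by apply/eqP; apply/eqP/eqP => /E.
Qed.
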